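(* The following problems are $\mathsf{Lossy}$-complete (each is $\le_{dt}$-reducible to $\textsc{Lossy-Code}$, and $\textsc{Lossy-Code}$ is $\le_{dt}$-reducible to each): (i) $c$-$\textsc{AMGM-LC}$ for every constant $c>1$; (ii) $c$-$\textsc{Dual-AMGM-LC}$ for every $0<c<2$; (iii) $\textsc{Inclusion-Exclusion}$.
   Context: Query model with $\le_{dt}$ reductions (decision-tree reductions with log target-input-length plus depth $\mathrm{polylog}$ in the source size). $\textsc{Lossy-Code}$: given $f:[M]\to[2M]$, $g:[2M]\to[M]$, find $x\in[2M]$ with $f(g(x))\ne x$. $c$-$\textsc{AMGM-LC}$: $V=[2N]$, $P=[cN^2]$; input $C:V\to\{0,1\}$, $F:P\to V\times V$, $G:V\times V\to P$; solution: $x\in P$ with $G(F(x))\ne x$ or $F(x)\notin C^{-1}(0)\times C^{-1}(1)$. $c$-$\textsc{Dual-AMGM-LC}$: $V=[2N]$, $H=[cN^2]$; input $C:V\to\{0,1\}$, $F:H\to V\times V$, $G:V\times V\to H$; solution: $x\in\{(u,v):C(u)=C(v)\}$ with $F(G(x))\ne x$. $\textsc{Inclusion-Exclusion}$: parameters $N$, $\ell\le\mathrm{polylog}(N)$, $\varepsilon>1/\mathrm{polylog}(N)$; table $T\subseteq[\ell]\times[N]$, $S_i=\{j:T_{i,j}=1\}$; numbers $a_i,a_{i,j}\in[0,N]$ with $\tilde a=\sum_ia_i-\sum_{i<j}a_{i,j}\ge\varepsilon N$; maps $f_i:[a_i]\to[N]$, $g_i:[N]\to[a_i]$, $f_{i,j}:[a_{i,j}]\to[N]$,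 $g_{i,j}:[N]\to[a_{i,j}]$, $\tilde f:[\tilde a-\varepsilon N]\to[N]$, $\tilde g:[N]\to[\tilde a-\varepsilon N]$; a solution is $i$, $x\in[a_i]$ with $T_{i,f_i(x)}=0$ or $g_i(f_i(x))\ne x$; or $i<j$, $x\in[N]$ with $T_{i,x}=T_{j,x}=1$ and $f_{i,j}(g_{i,j}(x))\ne x$; or $x\in[N]$ with $\tilde f(\tilde g(x))\ne x$ and $T_{j,x}=1$ for some $j$. *)

(* Defs.v *)
From HB Require Import structures.
From mathcomp Require Import all_boot all_order all_algebra.
From mathcomp Require Import reals.

Set Implicit Arguments.
Unset Strict Implicit.
Unset Printing Implicit Defensive.

Import Order.TTheory GRing.Theory Num.Theory.

Inductive dtree (X A : Type) : Type :=
| Leaf of A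
| Query of X & dtree X A & dtree X A.

Fixpoint depth X A (t : dtree X A) : nat :=
  match t with
  | Leaf _ => 0
  | Query _ t0 t1 => (maxn (depth t0) (depth t1)).+1
  end.

(* The second subtree is followed when the queried bit is 1. *)
Fixpoint eval X A (q : X -> bool) (t : dtree X A) : A :=
  match t with
  | Leaf a => a
  | Query x t0 t1 => if q x then eval q t1 else eval q t0
  end.

(* A search problem of one fixed size.  An input w is presented as the bit
   string (query w v), v ranging over positions; only the strings of this form
   are legal inputs. *)
Record problem : Type := Problem {
  input : Type;
  position : finType;
  query : input -> position -> bool;
  solution : finType;
  solves : input -> solution -> bool
}.

Record search_family : Type := SearchFamily {
  idx : Type;
  member : idx -> problem
}.

Definition input_length (P : problem) : nat := #|position P|.

(* Every polylogarithmic function of n is at most polylog k for some k. *)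
Definition polylog (k n : nat) : nat := up_log 2 n ^ k + k.

Definition reduction (P Q : problem) (d : nat) : Prop :=
  exists (F : input P -> input Q)
         (tin : position Q -> dtree (position P) bool)
         (tout : solution Q -> dtree (position P) (solution P)),
  [/\ forall v, depth (tin v) <= d,
      forall s, depth (tout s) <= d,
      forall w v, query (F w) v = eval (query w) (tin v)
    & forall w s, solves (F w) s -> solves w (eval (query w) (tout s))].

Definition dt_reducible (A B : search_family) : Prop :=
  exists k : nat, forall i : idx A, exists (j : idx B) (d : nat),
    reduction (member i) (member j) d /\
    up_log 2 (input_length (member j)) + d
      <= polylog k (input_length (member i)).

(* Elements of [K] are written in binary with up_log 2 K bits. *)
Definition bitpos (K : nat) : finType := 'I_(up_log 2 K).
Definition bit (v b : nat) : bool := odd (v %/ 2 ^ b).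

Definition lossy_problem (M : nat) : problem := {|
  input := ('I_M -> 'I_(2 * M)) * ('I_(2 * M) -> 'I_M);
  position := ('I_M * bitpos (2 * M) + 'I_(2 * M) * bitpos M)%type;
  query w v :=
    match v with
    | inl (x, b) => bit (w.1 x) b
    | inr (y, b) => bit (w.2 y) b
    end;
  solution := 'I_(2 * M);
  solves w x := w.1 (w.2 x) != x
|}.

Definition lossy_code : search_family :=
  @SearchFamily {M : nat | 0 < M} (fun M => lossy_problem (val M)).

Definition lossy_complete (A : search_family) : Prop :=
  dt_reducible A lossy_code /\ dt_reducible lossy_code A.

(* A colouring C of V = [2N] with maps F : [m] -> V * V and G : V * V -> [m]. *)
Record graph_input (N m : nat) : Type := GraphInput {
  gC : 'I_(2 * N) -> bool;
  gF : 'I_m -> 'I_(2 * N) * 'I_(2 * N);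
  gG : 'I_(2 * N) * 'I_(2 * N) -> 'I_m
}.

(* In the positions of F, the boolean selects a component of the pair. *)
Definition graph_position (N m : nat) : finType :=
  ('I_(2 * N) + 'I_m * bool * bitpos (2 * N)
   + 'I_(2 * N) * 'I_(2 * N) * bitpos m)%type.

Definition graph_query N m (w : graph_input N m) (v : graph_position N m) :=
  match v with
  | inl (inl u) => gC w u
  | inl (inr (x, side, b)) => bit (if side then (gF w x).2 else (gF w x).1) b
  | inr (u1, u2, b) => bit (gG w (u1, u2)) b
  end.

Definition amgm_problem (N m : nat) : problem := {|
  input := graph_input N m;
  position := graph_position N m;
  query := @graph_query N m;
  solution := 'I_m;
  solves w x := (gG w (gF w x) != x)
                || ~~ (~~ gC w (gF w x).1 && gC w (gF w x).2)
|}.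

Definition dual_amgm_problem (N m : nat) : problem := {|
  input := graph_input N m;
  position := graph_position N m;
  query := @graph_query N m;
  solution := ('I_(2 * N) * 'I_(2 * N))%type;
  solves w x := (gC w x.1 == gC w x.2) && (gF w (gG w x) != x)
|}.

(* When c N^2 is not an integer, it is rounded so that a solution exists for
   every N > 0: up here, since m > N^2 is needed, and down in the dual problem,
   where m < 2 N^2 is needed. *)
Definition amgm_lc (R : realType) (c : R) : search_family :=
  @SearchFamily {N : nat | 0 < N}
    (fun N => amgm_problem (val N) `|Num.ceil (c * (val N)%:R ^+ 2)%R|%N).

Definition dual_amgm_lc (R : realType) (c : R) : search_family :=
  @SearchFamily {N : nat | 0 < N}
    (fun N => dual_amgm_problem (val N) (Num.truncn (c * (val N)%:R ^+ 2)%R)).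

Definition opair (l : nat) : finType := {p : 'I_l * 'I_l | p.1 < p.2}.

Definition atilde (R : realType) (N l : nat)
    (a1 : 'I_l -> 'I_N.+1) (a2 : opair l -> 'I_N.+1) : R :=
  (\sum_i (a1 i)%:R - \sum_p (a2 p)%:R)%R.

Definition ie_size (R : realType) (N l : nat) (eps : R)
    (a1 : 'I_l -> 'I_N.+1) (a2 : opair l -> 'I_N.+1) : nat :=
  Num.truncn (atilde R a1 a2 - eps * N%:R)%R.

(* The codomain of a map [N] -> [a] is written 'I_(maxn a 1): this is 'I_a if
   a > 0, and it keeps a = 0 (e.g. disjoint S_i and S_j) from ruling out the
   whole input; see not_retract. *)
Record ie_input (R : realType) (N l : nat) (eps : R) : Type := IEInput {
  ieT : 'I_l -> 'I_N -> bool;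
  iea1 : 'I_l -> 'I_N.+1;
  iea2 : opair l -> 'I_N.+1;
  ie_ge : (eps * N%:R <= atilde R iea1 iea2)%R;
  ief1 : forall i, 'I_(iea1 i) -> 'I_N;
  ieg1 : forall i, 'I_N -> 'I_(maxn (iea1 i) 1);
  ief2 : forall p, 'I_(iea2 p) -> 'I_N;
  ieg2 : forall p, 'I_N -> 'I_(maxn (iea2 p) 1);
  ieft : 'I_(ie_size eps iea1 iea2) -> 'I_N;
  iegt : 'I_N -> 'I_(maxn (ie_size eps iea1 iea2) 1)
}.

Arguments ief1 {R N l eps} w i _ : rename.
Arguments ieg1 {R N l eps} w i _ : rename.
Arguments ief2 {R N l eps} w p _ : rename.
Arguments ieg2 {R N l eps} w p _ : rename.
Arguments ieft {R N l eps} w _ : rename.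
Arguments iegt {R N l eps} w _ : rename.

(* f (g x) <> x; if a = 0 then f (g x) is undefined, which counts as <> x. *)
Definition not_retract (a N : nat)
    (f : 'I_a -> 'I_N) (g : 'I_N -> 'I_(maxn a 1)) (x : 'I_N) : bool :=
  if insub (val (g x)) is Some y then f y != x else true.

(* Reading a bit of f x when x lies outside the domain [a] of f returns 0. *)
Definition pad_bit (a N : nat) (f : 'I_a -> 'I_N) (x b : nat) : bool :=
  if insub x is Some y then bit (f y) b else false.

(* The numbers a_i, a_ij are part of the input, so that the tables of positions
   use the upper bounds a_i, a_ij <= N and atilde <= l N for the domains. *)
Definition ie_position (N l : nat) : finType :=
  ('I_l * 'I_N                                  (* T *)
   + 'I_l * bitpos N.+1                         (* a_i *)
   + opair l * bitpos N.+1                      (* a_ij *)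
   + ('I_l + opair l) * 'I_N * bitpos N         (* f_i, f_ij *)
   + ('I_l + opair l) * 'I_N * bitpos N         (* g_i, g_ij *)
   + 'I_(l * N) * bitpos N                      (* ftilde *)
   + 'I_N * bitpos (l * N))%type.               (* gtilde *)

Definition ie_query R N l eps (w : @ie_input R N l eps)
    (v : ie_position N l) : bool :=
  match v with
  | inl (inl (inl (inl (inl (inl (i, x)))))) => ieT w i x
  | inl (inl (inl (inl (inl (inr (i, b)))))) => bit (iea1 w i) b
  | inl (inl (inl (inl (inr (p, b))))) => bit (iea2 w p) b
  | inl (inl (inl (inr (inl i, x, b)))) => pad_bit (ief1 w i) x b
  | inl (inl (inl (inr (inr p, x, b)))) => pad_bit (ief2 w p) x b
  | inl (inl (inr (inl i, x, b))) => bit (ieg1 w i x) b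
  | inl (inl (inr (inr p, x, b))) => bit (ieg2 w p x) b
  | inl (inr (x, b)) => pad_bit (ieft w) x b
  | inr (x, b) => bit (iegt w x) b
  end.

Definition ie_solution (N l : nat) : finType :=
  ('I_l * 'I_N + opair l * 'I_N + 'I_N)%type.

Definition ie_solves R N l eps (w : @ie_input R N l eps)
    (s : ie_solution N l) : bool :=
  match s with
  | inl (inl (i, x)) =>
      if insub (val x) is Some y
      then ~~ ieT w i (ief1 w i y)
           || (val (ieg1 w i (ief1 w i y)) != val y)
      else false
  | inl (inr (p, x)) =>
      [&& ieT w (val p).1 x, ieT w (val p).2 x
        & not_retract (ief2 w p) (ieg2 w p) x]
  | inr x => not_retract (ieft w) (iegt w) x && [exists j, ieT w j x]
  end.

Definition ie_problem (R : realType) (N l : nat) (eps : R) : problem := {|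
  input := @ie_input R N l eps;
  position := ie_position N l;
  query := @ie_query R N l eps;
  solution := ie_solution N l;
  solves := @ie_solves R N l eps
|}.

Record ie_index (R : realType) (k : nat) : Type := IEIndex {
  ieN : nat;
  iel : nat;
  ieeps : R;
  ieN_gt0 : 0 < ieN;
  iel_le : iel <= polylog k ieN;
  ieeps_gt : ((polylog k ieN)%:R^-1 < ieeps)%R
}.

Definition inclusion_exclusion (R : realType) (k : nat) : search_family :=
  @SearchFamily (ie_index R k) (fun i => ie_problem (ieN i) (iel i) (ieeps i)).

(* Main.v *)
Require Import Defs.
From mathcomp Require Import all_boot all_order all_fingroup all_algebra.
From mathcomp Require Import reals.
From mathcomp Require Import zify ring lra.

(* All reductions pass through one notion: a "lossy retraction" S -> B -> S of
   finite sets, computable by shallow decision trees, such that every point of B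
   not fixed by B -> S -> B yields a solution of the source problem.  Such a
   retraction with 2|S| <= |B| is a reduction to Lossy-Code, and conversely
   iterating the maps of Lossy-Code gives such retractions with |B|/|S| as large
   as wanted.

   Lossy-Code to the other problems: colour half of V with each colour (or take
   a single set S_1 = [N] in Inclusion-Exclusion).

   AMGM to Lossy-Code: no counting of colour classes is available to a shallow
   tree, but [m]^k times the balanced colour patterns of length 2k embeds in
   V^(2k), and c^k 'C(2k, k) exceeds 2 * 4^k for a constant k.

   Dual AMGM to Lossy-Code: since 'C(2k+1, i) <= poly(k) 2^k 'C(k, i/2), a
   colour pattern of length 2k+1 can be rearranged into k monochromatic pairs and
   a single letter at the price of only k + O(log k) bits of advice; so V^(2k+1)
   embeds in [m]^k * V * [poly(k) 2^k], and (c/2)^k poly(k) is small.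

   Inclusion-Exclusion to Lossy-Code: the Bonferroni inequality has an explicit
   injective proof, whose slack 1 + 1/polylog is amplified by a power. *)

Set Implicit Arguments.
Unset Strict Implicit.
Unset Printing Implicit Defensive.

Import Order.TTheory GRing.Theory Num.Theory.

(** * Decision-tree computability *)

Fixpoint tree_bind X A B (t : dtree X A) (k : A -> dtree X B) : dtree X B :=
  match t with
  | Leaf a => k a
  | Query x t0 t1 => Query x (tree_bind t0 k) (tree_bind t1 k)
  end.

(** [h] lives on inputs rather than on bit strings, so the tree only has to be correct on legal
    inputs. *)
Definition computable (P : problem) (d : nat) T (h : input P -> T) : Prop :=
  exists2 t : dtree (position P) T,
    depth t <= d & forall w, h w = eval (query w) t.

Lemma computable_const (P : problem) d T (a : T) :
  computable d (fun _ : input P => a).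
Proof. by exists (Leaf _ a). Qed.

Lemma computable_ext (P : problem) d T (h h' : input P -> T) :
  h =1 h' -> computable d h -> computable d h'.
Proof. by move=> e [t ht E]; exists t => // w; rewrite -e. Qed.

Lemma computable_weaken (P : problem) d d' T (h : input P -> T) :
  d <= d' -> computable d h -> computable d' h.
Proof. by move=> le [t ht E]; exists t => //; apply: leq_trans le. Qed.

Lemma computable_query (P : problem) (v : position P) :
  computable 1 (fun w : input P => query w v).
Proof. by exists (Query v (Leaf _ false) (Leaf _ true)) => // w /=; case: ifP. Qed.

Lemma computable_bind (P : problem) d1 d2 A T (h : input P -> A)
    (k : A -> input P -> T) :
  computable d1 h -> (forall a, computable d2 (k a)) ->
  computable (d1 + d2) (fun w => k (h w) w).
Proof.
move=> [t ht E] Hk.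
(* The tree for [k a] is chosen leaf by leaf along [t], which avoids a choice over all of [A]. *)
have [t' lt' E'] : exists2 t', depth t' <= depth t + d2 &
    forall w, k (eval (query w) t) w = eval (query w) t'.
  elim: t {ht E} => [a | x t0 [u0 l0 E0] t1 [u1 l1 E1]] /=.
    by have [u lu Eu] := Hk a; exists u.
  exists (Query x u0 u1) => /=; last by move=> w; case: (query w x).
  lia.
exists t'; first by lia.
by move=> w; rewrite E.
Qed.

Lemma computable_map (P : problem) d A T (phi : A -> T) (h : input P -> A) :
  computable d h -> computable d (fun w => phi (h w)).
Proof.
move=> H; rewrite -[d]addn0.
by apply: (computable_bind (k := fun a _ => phi a) H) => a; apply: computable_const.
Qed.

Lemma computable_tuple (P : problem) d n T (h : 'I_n -> input P -> T) :
  (forall i, computable d (h i)) ->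
  computable (n * d) (fun w => [tuple h i w | i < n]).
Proof.
elim: n h => [|n IHn] h Hh.
  apply: (computable_ext (h := fun=> [tuple])); last exact: computable_const.
  by move=> w; rewrite [RHS]tuple0.
rewrite mulSn.
apply: (computable_ext
  (h := fun w => cons_tuple (h ord0 w) [tuple h (lift ord0 i) w | i < n])).
  move=> w; apply: eq_from_tnth => i; rewrite tnth_mktuple.
  by case: (unliftP ord0 i) => [j|] ->; rewrite ?tnthS ?tnth0 ?tnth_mktuple.
apply: (computable_bind (k := fun a w => cons_tuple a _)) => // a.
apply: (computable_map (fun t => cons_tuple a t)).
by apply: IHn.
Qed.

Lemma computable_ffun (P : problem) d (I : finType) T (h : I -> input P -> T) :
  (forall i, computable d (h i)) ->
  computable (#|I| * d) (fun w => [ffun i => h i w]).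
Proof.
move=> Hh.
apply: (computable_ext (h := fun w => [ffun i =>
   tnth [tuple h (enum_val i) w | i < #|I|] (enum_rank i)])).
  by move=> w; apply/ffunP => i; rewrite !ffunE tnth_mktuple enum_rankK.
apply: (computable_map (fun t : #|I|.-tuple T => [ffun i => tnth t (enum_rank i)])).
exact: computable_tuple.
Qed.

Lemma computable_bits (P : problem) d u (h : input P -> nat) :
  (forall w, h w < 2 ^ u) ->
  (forall b : 'I_u, computable d (fun w => bit (h w) b)) ->
  computable (u * d) h.
Proof.
elim: u h => [|u IHu] h lth Hb.
  apply: (computable_ext (h := fun=> 0)); last exact: computable_const.
  by move=> w; have := lth w; case: (h w).
apply: (computable_ext (h := fun w => bit (h w) 0 + (h w)./2.*2)).
  by move=> w; rewrite /bit divn1 odd_double_half.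
rewrite mulSn.
apply: (computable_bind (k := fun a w => nat_of_bool a + (h w)./2.*2)).
  exact: (Hb ord0).
move=> a; apply: (computable_map (fun x => nat_of_bool a + x.*2)).
apply: IHu => [w | b].
  by have := lth w; rewrite expnS mul2n; lia.
apply: computable_ext (Hb (lift ord0 b)) => w.
by rewrite /bit /= /bump /= add1n expnS divnMA divn2.
Qed.

Lemma computable_ord (P : problem) K d (x0 : 'I_K) (h : input P -> 'I_K) :
  (forall b : bitpos K, computable d (fun w => bit (h w) b)) ->
  computable (up_log 2 K * d) h.
Proof.
move=> Hb; apply: (computable_ext (h := fun w => insubd x0 (val (h w)))).
  by move=> w; rewrite valKd.
apply: (computable_map (insubd x0)); apply: computable_bits => // w.
by apply: leq_trans (ltn_ord _) _; apply: up_logP.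
Qed.

Lemma reductionI (P Q : problem) d (F : input P -> input Q)
    (s : solution Q -> input P -> solution P) :
  (forall v, computable d (fun w => query (F w) v)) ->
  (forall x, computable d (s x)) ->
  (forall w x, solves (F w) x -> solves w (s x w)) ->
  reduction P Q d.
Proof.
move=> /fin_all_exists2[tin tinP tinE] /fin_all_exists2[tout toutP toutE] H.
exists F, tin, tout; split=> // w x; rewrite -toutE; exact: H.
Qed.

(** * Lossy retractions *)

(* The second bound [e] is the cost of turning a point of [B] that is not
   fixed into a solution of [P]. *)
Definition lossy_retract (P : problem) (S B : finType) (d e : nat) : Prop :=
  exists (f : S -> input P -> B) (g : B -> input P -> S)
         (s : B -> input P -> solution P),
  [/\ forall x, computable d (f x), forall y, computable d (g y),
      forall y, computable e (s y)
    & forall w y, f (g y w) w != y -> solves w (s y w)].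

Lemma lossy_retract_weaken P S B d e d' e' :
  d <= d' -> e <= e' -> lossy_retract P S B d e -> lossy_retract P S B d' e'.
Proof.
move=> ld le [f [g [s [cf cg cs H]]]]; exists f, g, s.
by split=> // x; [apply: computable_weaken (cf x) | apply: computable_weaken (cg x)
  | apply: computable_weaken (cs x)].
Qed.

Lemma leq_card_injective (S T : finType) :
  #|S| <= #|T| -> exists i : S -> T, injective i.
Proof.
move=> le; exists (fun x => enum_val (widen_ord le (enum_rank x))).
move=> x y /enum_val_inj /(congr1 val) /= /val_inj; exact: enum_rank_inj.
Qed.

(** [S] embeds into [S'] and [B'] into [B]. Points of [S'] outside the image go to an arbitrary
    [b0]; if [y] moves in [B'], then [j y] moves in [B]. *)
Lemma lossy_retract_resize P (S B S' B' : finType) d e :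
  #|S| <= #|S'| -> 0 < #|B'| <= #|B| ->
  lossy_retract P S B d e -> lossy_retract P S' B' d e.
Proof.
move=> /leq_card_injective[i i_inj] /andP[/card_gt0P[b0 _]].
move=> /leq_card_injective[j j_inj] [f [g [s [cf cg cs H]]]].
pose j' b := odflt b0 [pick y | j y == b].
have jK y : j' (j y) = y.
  by rewrite /j'; case: pickP => [z /eqP/j_inj|/(_ y)]; rewrite ?eqxx.
exists (fun z w => if [pick x | i x == z] is Some x then j' (f x w) else b0),
  (fun y w => i (g (j y) w)), (fun y => s (j y)); split=> //.
- by move=> z; case: pickP => [x _|_]; [apply: computable_map | apply: computable_const].
- by move=> y; apply: computable_map.
move=> w y; case: pickP => [x /eqP/i_inj->|/(_ (g (j y) w))]; last by rewrite eqxx.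
by move=> ne; apply: H; apply: contraNneq ne => ->; rewrite jK.
Qed.

(** If [y] moves under the whole round trip, then either [g2 y] moves between [T] and [S], or [y]
    moves between [U] and [T]. Deciding which costs the inner round trip at [g2 y]. *)
Lemma lossy_retract_comp P (S T U : finType) d1 e1 d2 e2 :
  lossy_retract P S T d1 e1 -> lossy_retract P T U d2 e2 ->
  lossy_retract P S U (d1 + d2) (d2 + (d1 + d1) + (e1 + e2)).
Proof.
move=> [f1 [g1 [s1 [cf1 cg1 cs1 H1]]]] [f2 [g2 [s2 [cf2 cg2 cs2 H2]]]].
exists (fun x w => f2 (f1 x w) w), (fun y w => g1 (g2 y w) w),
  (fun y w => if f1 (g1 (g2 y w) w) w != g2 y w then s1 (g2 y w) w else s2 y w).
split=> [x|y|y|w y].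
- exact: computable_bind.
- by rewrite addnC; apply: computable_bind.
- rewrite -addnA.
  apply: (computable_bind (k := fun z w =>
    if f1 (g1 z w) w != z then s1 z w else s2 y w)) => // z.
  apply: (computable_bind (h := fun w => f1 (g1 z w) w)
     (k := fun z' w => if z' != z then s1 z w else s2 y w)).
    exact: computable_bind.
  move=> z' /=; case: (z' != z).
    by apply: computable_weaken (cs1 z); rewrite leq_addr.
  by apply: computable_weaken (cs2 y); rewrite leq_addl.
case: ifPn => [/H1 //|/negPn/eqP->] ne; exact: H2.
Qed.

Lemma lossy_retract_prod P (T S B : finType) d e :
  lossy_retract P S B d e -> lossy_retract P (T * S)%type (T * B)%type d e.
Proof.
move=> [f [g [s [cf cg cs H]]]].
exists (fun x w => (x.1, f x.2 w)), (fun y w => (y.1, g y.2 w)), (fun y => s y.2).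
split=> // [x|y|w [t y] /= ne].
- exact: (computable_map (pair x.1)).
- exact: (computable_map (pair y.1)).
by apply: H; apply: contraNneq ne => ->.
Qed.

(** Each level adds one bit and one test of cost at most [k * d + (d + d) + e], so the total stays
    quadratic in [k]. *)
Lemma lossy_retract_iter P (S : finType) d e k :
  lossy_retract P S (bool * S)%type d e ->
  exists2 B : finType, #|B| = 2 ^ k * #|S|
    & lossy_retract P S B (k * d) (k.+1 * (k * d + (d + d) + e)).
Proof.
move=> base; elim: k => [|k [B cB IHk]].
  exists S; first by rewrite mul1n.
  have [f [g [s [_ _ cs H]]]] := base.
  exists (fun x _ => x), (fun x _ => x), (fun x => s (true, x)).
  split=> [x|x|x|w y]; last by rewrite eqxx.
  - exact: computable_const.
  - exact: computable_const.
  by apply: computable_weaken (cs _); lia.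
exists (bool * B)%type; first by rewrite card_prod card_bool cB expnS mulnA.
apply: lossy_retract_weaken
  (lossy_retract_comp base (lossy_retract_prod bool IHk)); lia.
Qed.

(** Acting coordinatewise raises the ratio of the sizes to the power [r.+1]. Finding a moving
    coordinate costs all the round trips, but [s] is then evaluated only once. *)
Lemma lossy_retract_power P (S B : finType) d e r :
  lossy_retract P S B d e ->
  lossy_retract P {ffun 'I_r.+1 -> S} {ffun 'I_r.+1 -> B}
    (r.+1 * d) (r.+1 * (d + d) + e).
Proof.
move=> [f [g [s [cf cg cs H]]]].
exists (fun (x : {ffun 'I_r.+1 -> S}) w => [ffun i => f (x i) w]),
  (fun (y : {ffun 'I_r.+1 -> B}) w => [ffun i => g (y i) w]).
pose fg (y : {ffun 'I_r.+1 -> B}) w := [ffun i => f (g (y i) w) w].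
pose bad (y z : {ffun 'I_r.+1 -> B}) := odflt ord0 [pick i | z i != y i].
exists (fun (y : {ffun 'I_r.+1 -> B}) w => s (y (bad y (fg y w))) w).
split=> [x|y|y|w y ne].
- by rewrite -[X in X * _]card_ord; apply: computable_ffun.
- by rewrite -[X in X * _]card_ord; apply: computable_ffun.
- apply: (computable_bind (k := fun z => s (y (bad y z)))) => //.
  rewrite -[X in X * _]card_ord; apply: computable_ffun => i.
  exact: computable_bind.
apply: H; rewrite /bad; case: pickP => [i|all_ok]; first by rewrite ffunE.
case/eqP: ne; apply/ffunP => i.
by have /negbFE/eqP := all_ok i; rewrite !ffunE.
Qed.

Lemma lossy_retract_reduction P (S B : finType) d e :
  lossy_retract P S B d e -> 0 < #|S| -> 2 * #|S| <= #|B| ->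
  reduction P (lossy_problem #|S|) (maxn d e).
Proof.
move=> SB S_gt0 le.
have [] : lossy_retract P 'I_#|S| 'I_(2 * #|S|) d e.
  by apply: lossy_retract_resize SB; rewrite ?card_ord ?le //; lia.
move=> f [g [s [cf cg cs H]]].
apply: (@reductionI P (lossy_problem #|S|) _
  (fun w : input P => ((fun x => f x w), (fun y => g y w))) s) => [[[x b]|[y b]]|y|//].
- apply: (computable_map (fun v => bit (val v) b)).
  by apply: computable_weaken (cf x); rewrite leq_maxl.
- apply: (computable_map (fun v => bit (val v) b)).
  by apply: computable_weaken (cg y); rewrite leq_maxl.
by apply: computable_weaken (cs y); rewrite leq_maxr.
Qed.

(** An input of Lossy-Code is itself a lossy retraction with [e = 0], a moving point being its own
    solution. It is doubled [k] times and resized. *)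
Lemma lossy_retract_lossy M k (S B : finType) (u := up_log 2 (2 * M)) :
  0 < M <= #|S| -> 0 < #|B| <= 2 ^ k * M ->
  lossy_retract (lossy_problem M) S B (k * u) (k.+1 * (k.+2 * u)).
Proof.
move=> /andP[M_gt0 leS] /andP[B_gt0 leB].
have base : lossy_retract (lossy_problem M) 'I_M 'I_(2 * M) u 0.
  have M2_gt0 : 0 < 2 * M by lia.
  exists (fun x (w : input (lossy_problem M)) => w.1 x),
    (fun y (w : input (lossy_problem M)) => w.2 y), (fun y _ => y); split=> //.
  - move=> x; rewrite -[u]muln1; apply: (computable_ord (Ordinal M2_gt0)) => b.
    exact: (@computable_query (lossy_problem M) (inl (x, b))).
  - move=> y; apply: (@computable_weaken _ (up_log 2 M * 1)).
      by rewrite muln1; apply: leq_up_log; lia.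
    apply: (computable_ord (Ordinal M_gt0)) => b.
    exact: (@computable_query (lossy_problem M) (inr (y, b))).
  by move=> y; apply: computable_const.
have /(lossy_retract_iter k)[B' cB'] :
    lossy_retract (lossy_problem M) 'I_M (bool * 'I_M)%type u 0.
  by apply: lossy_retract_resize base; rewrite ?card_prod ?card_bool ?card_ord //; lia.
rewrite card_ord in cB'.
have -> : k * u + (u + u) + 0 = k.+2 * u by lia.
by apply: lossy_retract_resize; rewrite ?card_ord ?cB' ?B_gt0.
Qed.

(** * Binomial coefficients and rearrangements *)

(** Elements are matched within each fibre by their rank in its enumeration. *)
Lemma fiberwise_injection (X Y : finType) (W : eqType) (wX : X -> W) (wY : Y -> W) :
  (forall i, #|[set x | wX x == i]| <= #|[set y | wY y == i]|) ->
  exists2 h : X -> Y, injective h & forall x, wY (h x) = wX x.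
Proof.
move=> le; pose eX i := enum [set x | wX x == i]; pose eY i := enum [set y | wY y == i].
have inX x : x \in eX (wX x) by rewrite mem_enum inE.
have [h hP] : exists h : X -> Y, forall x, wY (h x) = wX x
    /\ index (h x) (eY (wX x)) = index x (eX (wX x)).
  suff : forall x, exists y, wY y = wX x
      /\ index y (eY (wX x)) = index x (eX (wX x)) by move/fin_all_exists.
  move=> x; case E: (eY (wX x)) => [|y0 s].
    by have := le (wX x); rewrite !cardE -/(eY _) -/(eX _) E leqn0 size_eq0 => /eqP E';
       have := inX x; rewrite E'.
  have ltx : index x (eX (wX x)) < size (y0 :: s).
    by rewrite -E -cardE; apply: leq_trans (le _); rewrite cardE index_mem.
  have : nth y0 (y0 :: s) (index x (eX (wX x))) \in eY (wX x).
    by rewrite E mem_nth.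
  rewrite mem_enum inE => /eqP wE.
  exists (nth y0 (y0 :: s) (index x (eX (wX x)))); split=> //.
  by rewrite index_uniq // -E enum_uniq.
exists h => [x y eq_h | x]; last by case: (hP x).
have [wx ix] := hP x; have [wy iy] := hP y.
have eq_w : wX x = wX y by rewrite -wx -wy eq_h.
by rewrite -[x](nth_index x (inX x)) -ix -(nth_index x (inX y)) -iy eq_h eq_w.
Qed.

(** The complements also have equal size, so membership can be preserved fibrewise, and an injection
    of a finite type into itself is a permutation. *)
Lemma perm_onto_set (T : finType) (A B : {set T}) :
  #|A| = #|B| -> exists s : {perm T}, forall x, (s x \in B) = (x \in A).
Proof.
move=> eqAB.
have [b|h h_inj hP] := @fiberwise_injection T T _ (mem A) (mem B).
  have sE (C : {set T}) : [set x | mem C x == b] = if b then C else ~: C.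
    by apply/setP => x; rewrite inE /=; case: b; rewrite ?inE ?eqb_id // eqbF_neg.
  rewrite !sE; case: b {sE}; rewrite ?eqAB //.
  have := cardsC A; have := cardsC B; lia.
by exists (perm h_inj) => x; rewrite permE; apply: hP.
Qed.

(** After multiplication by [s.+1 * t.+1] both sides share the factor ['C(n, s) * 'C(n, t)]; what
    remains is [s.+1 * (n - t) <= (n - s) * t.+1]. *)
Lemma bin_log_concave n s t :
  s <= t -> 'C(n, s) * 'C(n, t.+1) <= 'C(n, s.+1) * 'C(n, t).
Proof.
move=> le_st.
rewrite -(@leq_pmul2l (s.+1 * t.+1)) //.
rewrite (mulnACA s.+1 _ 'C(n, s)) (mulnACA s.+1 _ 'C(n, s.+1)) !mul_bin_left.
rewrite (mulnACA s.+1) (mulnACA (n - s)) leq_mul2r (mulnC (n - s)).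
by apply/orP; right; apply: leq_mul; lia.
Qed.

(** By log-concavity the product grows as two indices of fixed sum [i] approach each other. Symmetry
    leaves [s <= i./2], treated by induction on the distance to [i./2]. *)
Lemma bin_mul_half n i s :
  s <= i -> 'C(n, s) * 'C(n, i - s) <= 'C(n, i./2) * 'C(n, uphalf i).
Proof.
suff H s' : s' <= i./2 -> 'C(n, s') * 'C(n, i - s') <= 'C(n, i./2) * 'C(n, uphalf i).
  move=> le_si; have [/H//|lt_s] := leqP s i./2.
  by have := H (i - s); rewrite subKn // mulnC; apply; lia.
move=> le_s; rewrite -(subKn le_s); move: (i./2 - s') (leq_subr s' i./2) => d.
elim: d => [|d IHd] le_d; first by rewrite subn0; have -> : i - i./2 = uphalf i by lia.
apply: leq_trans (IHd _); last by lia.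
have -> : i - (i./2 - d.+1) = (i - (i./2 - d)).+1 by lia.
have -> : i./2 - d = (i./2 - d.+1).+1 by lia.
apply: bin_log_concave; lia.
Qed.

Lemma sum_bin n : \sum_(i < n.+1) 'C(n, i) = 2 ^ n.
Proof.
by rewrite -[2]/(1 + 1) expnDn; apply: eq_bigr => i _; rewrite !exp1n !muln1.
Qed.

Lemma bin_leq_exp2 n i : 'C(n, i) <= 2 ^ n.
Proof.
have [lt|le] := ltnP n i; first by rewrite bin_small.
by rewrite -sum_bin (bigD1 (inord i)) //= inordK ?leq_addr.
Qed.

(** The central coefficient is the largest in its row: by symmetry the square of ['C(2 * k, i)] is a
    product of two coefficients whose indices sum to [2 * k], so [bin_mul_half] applies. *)
Lemma central_bin_lower k : 2 ^ (2 * k) <= (2 * k).+1 * 'C(2 * k, k).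
Proof.
rewrite -sum_bin; apply: (@leq_trans (\sum_(i < (2 * k).+1) 'C(2 * k, k))); last first.
  by rewrite sum_nat_const card_ord.
apply: leq_sum => i _.
rewrite -leq_sqr -!mulnn -[X in _ * X <= _]bin_sub ?leq_ord //.
apply: leq_trans (bin_mul_half _ _) _; first by rewrite leq_ord.
by rewrite uphalf_half mul2n odd_double doubleK.
Qed.

(** Each of the at most [(2 * k).+2] terms of Vandermonde's sum is at most
    ['C(k, i./2) * 'C(k, uphalf i)]; one factor is kept, the other bounded by [2 ^ k]. *)
Lemma bin_double_leq k i j :
  i <= (2 * k).+1 -> j = i./2 \/ j = uphalf i ->
  'C(2 * k, i) <= (2 * k).+2 * (2 ^ k * 'C(k, j)).
Proof.
move=> le_i eq_j; have -> : 'C(2 * k, i) = \sum_(s < i.+1) 'C(k, s) * 'C(k, i - s).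
  by rewrite binomial.Vandermonde addnn mul2n.
apply: (@leq_trans (\sum_(s < i.+1) 2 ^ k * 'C(k, j))).
  apply: leq_sum => s _; apply: leq_trans (bin_mul_half _ _) _; first by rewrite leq_ord.
  case: eq_j => ->; last by rewrite leq_mul2r bin_leq_exp2 orbT.
  by rewrite mulnC leq_mul2r bin_leq_exp2 orbT.
by rewrite sum_nat_const card_ord leq_mul2r; apply/orP; right; lia.
Qed.

Lemma bin_odd_leq k i :
  'C((2 * k).+1, i) <= (4 * k.+1 * 2 ^ k) * 'C(k, i./2).
Proof.
have [lt|le] := ltnP (2 * k).+1 i; first by rewrite bin_small.
have -> : 4 * k.+1 * 2 ^ k * 'C(k, i./2)
   = (2 * k).+2 * (2 ^ k * 'C(k, i./2)) + (2 * k).+2 * (2 ^ k * 'C(k, i./2)).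
  by lia.
case: i le => [|i] le.
  by rewrite !bin0 !muln1 -(@prednK (2 ^ k)) ?expn_gt0 //; lia.
(* In Pascal's rule the half of [i.+1] is the upper half of [i], so both terms compare with the same
   coefficient. *)
rewrite binS; apply: leq_add; apply: bin_double_leq; lia.
Qed.

(** * AMGM and its dual as lossy retractions *)

Definition side T (q : T * T) (b : bool) : T := if b then q.2 else q.1.

(** The dual problem has the same inputs, positions and queries, so this lemma and the next two also
    apply to it, by conversion. *)
Lemma computable_gF N m (x : 'I_m) : 0 < N ->
  computable (P := amgm_problem N m) (2 * up_log 2 (2 * N)) (fun w => gF w x).
Proof.
move=> N_gt0; have v0 : 'I_(2 * N) by exists 0; lia.
have Hside b : computable (P := amgm_problem N m) (up_log 2 (2 * N))
    (fun w => side (gF w x) b).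
  rewrite -[up_log 2 _]muln1; apply: (computable_ord v0) => c.
  exact: (@computable_query (amgm_problem N m) (inl (inr (x, b, c)))).
apply: (computable_ext (h := fun w : input (amgm_problem N m) =>
  (side (gF w x) false, side (gF w x) true))); first by move=> w; case: (gF w x).
rewrite mul2n -addnn.
apply: (@computable_bind (amgm_problem N m) _ _ _ _ (fun w => side (gF w x) false)
  (fun u w => (u, side (gF w x) true))) => // u.
exact: (computable_map (pair u)).
Qed.

Lemma computable_gG N m p : 0 < m ->
  computable (P := amgm_problem N m) (up_log 2 m) (fun w => gG w p).
Proof.
move=> m_gt0; rewrite -[up_log 2 _]muln1; apply: (computable_ord (Ordinal m_gt0)) => c.
by case: p => u1 u2; exact: (@computable_query (amgm_problem N m) (inr (u1, u2, c))).
Qed.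

Lemma computable_gC N m u : computable (P := amgm_problem N m) 1 (fun w => gC w u).
Proof. exact: (@computable_query (amgm_problem N m) (inl (inl u))). Qed.

Lemma computable_amgm_solves N m (x : 'I_m) : 0 < N ->
  computable (2 * up_log 2 (2 * N) + up_log 2 m + 2)
    (fun w : input (amgm_problem N m) => solves w x).
Proof.
move=> N_gt0; have m_gt0 : 0 < m by case: x; lia.
pose P := amgm_problem N m; rewrite -addnA.
apply: (@computable_bind P _ _ _ _ (fun w => gF w x) (fun q w =>
  (gG w q != x) || ~~ (~~ gC w q.1 && gC w q.2))); first exact: computable_gF.
move=> q; apply: (@computable_bind P _ _ _ _ (fun w => gG w q) (fun z w =>
  (z != x) || ~~ (~~ gC w q.1 && gC w q.2))); first exact: computable_gG.
move=> z; apply: (@computable_bind P 1 1 _ _ (fun w => gC w q.1) (fun b w =>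
  (z != x) || ~~ (~~ b && gC w q.2))); first exact: computable_gC.
move=> b; apply: (computable_map (fun c => (z != x) || ~~ (~~ b && c))).
exact: computable_gC.
Qed.

Lemma card_side k : #|[set p : 'I_k * bool | p.2]| = k.
Proof.
have -> : [set p : 'I_k * bool | p.2] = setX setT [set true].
  by apply/setP => -[i b]; rewrite !inE eqb_id.
by rewrite cardsX cards1 muln1 cardsT card_ord.
Qed.

(* A word of length 2k in V is a pair of a colour pattern and an arrangement
   of its letters, so the words with k letters of each colour are covered by
   [m]^k once for each of the 'C(2k, k) balanced patterns. *)
Lemma amgm_lossy_retract N m k (d := k * (2 * up_log 2 (2 * N) + up_log 2 m + 2)) :
  0 < N -> 0 < m ->
  lossy_retract (amgm_problem N m)
    {ffun 'I_k * bool -> 'I_(2 * N)}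
    ({ffun 'I_k -> 'I_m} * {A : {set 'I_k * bool} | #|A| == k})%type
    d d.
Proof.
move=> N_gt0 m_gt0; pose x0 := Ordinal m_gt0.
(* [s A] moves [A] onto the second components of the pairs, which have colour 1 in every pair that
   is not a solution. *)
have [s sP] : exists s : {set 'I_k * bool} -> {perm 'I_k * bool},
    forall A : {set 'I_k * bool}, #|A| = k -> forall p, (s A p).2 = (p \in A).
  suff : forall A : {set 'I_k * bool}, exists s : {perm 'I_k * bool},
    #|A| = k -> forall p, (s p).2 = (p \in A) by move/fin_all_exists.
  move=> A; have [eqA|ne] := eqVneq #|A| k; last first.
    by exists (1%g) => eqA; rewrite eqA eqxx in ne.
  have [|s sP] := @perm_onto_set _ A [set p | p.2]; first by rewrite card_side.
  by exists s => _ p; rewrite -sP inE.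
have /eqP A0P := card_side k.
pose pattern := {A : {set 'I_k * bool} | #|A| == k}.
pose y0 : {ffun 'I_k -> 'I_m} * pattern :=
  ([ffun=> x0], exist (fun A : {set 'I_k * bool} => #|A| == k) _ A0P).
(* Words with an unbalanced pattern go to the default [y0]; none of them arises from a tuple without
   a solution. *)
pose dec (c : {ffun 'I_k * bool -> bool}) (v : {ffun 'I_k * bool -> 'I_(2 * N)})
    (w : input (amgm_problem N m)) : {ffun 'I_k -> 'I_m} * pattern :=
  let A := [set p | c p] in
  if (insub A : option pattern) is Some A' then
    ([ffun i => gG w (v ((s A)^-1%g (i, false)), v ((s A)^-1%g (i, true)))], A')
  else y0.
exists (fun (v : {ffun 'I_k * bool -> 'I_(2 * N)}) w => dec [ffun p => gC w (v p)] v w).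
exists (fun (y : {ffun 'I_k -> 'I_m} * pattern) (w : input (amgm_problem N m)) =>
  [ffun p => side ([ffun i => gF w (y.1 i)] (s (val y.2) p).1) (s (val y.2) p).2]).
exists (fun (y : {ffun 'I_k -> 'I_m} * pattern) (w : input (amgm_problem N m)) =>
  if [pick i | [ffun i => solves w (y.1 i : solution (amgm_problem N m))] i] is Some i
  then y.1 i else x0).
split=> [v|[x A]|[x A]|w [x A]].
- apply: (@computable_weaken _ (#|{: 'I_k * bool}| * 1 + #|'I_k| * up_log 2 m)).
    by rewrite card_prod card_bool !card_ord /d; lia.
  apply: (@computable_bind (amgm_problem N m) _ _ _ _
    (fun w => [ffun p => gC w (v p)]) (fun c w => dec c v w)).
    by apply: computable_ffun => p; apply: computable_gC.
  move=> c; rewrite /dec; case: insub => [A|]; last exact: computable_const.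
  apply: (computable_map (fun x => (x, A))).
  by apply: computable_ffun => i; apply: computable_gG.
- apply: (@computable_weaken _ (#|'I_k| * (2 * up_log 2 (2 * N)))).
    by rewrite card_ord /d leq_mul2l; lia.
  apply: (computable_map (fun q : {ffun 'I_k -> _} =>
    [ffun p => side (q (s (val A) p).1) (s (val A) p).2])).
  by apply: computable_ffun => i; apply: computable_gF.
- rewrite /d -[X in X * _]card_ord.
  apply: (computable_map (fun c : {ffun 'I_k -> bool} =>
     if [pick i | c i] is Some i then x i else x0)).
  by apply: computable_ffun => i; apply: computable_amgm_solves.
case: pickP => [i Pi|allok] ne; first by rewrite ffunE in Pi.
case/eqP: ne.
have FP i : [/\ gG w (gF w (x i)) = x i, gC w (gF w (x i)).1 = false
    & gC w (gF w (x i)).2 = true].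
  have := allok i; rewrite /= ffunE /= => /negbT; rewrite negb_or negbK.
  by case/andP => /eqP-> /negPn /andP[/negbTE-> ->].
(* All pairs being coloured 0, 1, the positions of colour 1 form exactly [A]: the pattern is
   recovered and tells which arrangement to undo. *)
have colour p : gC w (side (gF w (x (s (val A) p).1)) (s (val A) p).2) = (p \in val A).
  rewrite -(sP _ (eqP (valP A))); case: (s (val A) p) => i b.
  by have [_ C1 C2] := FP i; case: b.
rewrite /dec; set B := [set p | _].
have -> : B = val A by apply/setP => p; rewrite inE !ffunE colour.
rewrite valK; congr (_, _); apply/ffunP => i; rewrite !ffunE !permKV /=.
by have [] := FP i; case: (gF w (x i)).
Qed.

(** The positions of a word of length [2k+1] are grouped into [k] pairs and a single one; these are
    the colour patterns constant on each pair. *)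
Definition paired_set k (A : {set 'I_k}) (b : bool) : {set 'I_k * bool + unit} :=
  [set p | match p with inl q => q.1 \in A | inr _ => b end].

Lemma card_paired_set k (A : {set 'I_k}) b : #|paired_set A b| = 2 * #|A| + b.
Proof.
pose L : {set 'I_k * bool + unit} := inl @: setX A [set: bool].
pose R : {set 'I_k * bool + unit} := inr @: [set u : unit | b].
have -> : paired_set A b = L :|: R.
  apply/setP => -[[i c]|u]; rewrite !inE.
    rewrite mem_imset ?inE /=; last by move=> ? ? [].
    by case: (boolP (_ \in R)) => [/imsetP[]|]; rewrite ?andbT ?orbF.
  rewrite orbC mem_imset ?inE; last by move=> ? ? [].
  by case: (boolP (_ \in L)) => [/imsetP[]|]; rewrite ?orbF.
have -> : #|L :|: R| = #|L| + #|R|.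
  apply/eqP; rewrite (leq_card_setU L R).2 disjoint_subset; apply/subsetP => x.
  by case/imsetP => q _ ->; rewrite inE; apply/negP => /imsetP[].
rewrite !card_imset; try by move=> ? ? [].
rewrite cardsX cardsT card_bool mulnC; congr (_ + _).
case: b {L R}; first by rewrite (_ : [set _ | true] = setT) ?cardsT ?card_unit.
by rewrite (_ : [set _ | false] = set0) ?cards0.
Qed.

(* The inequality 'C(2k+1, i) <= E * 'C(k, i./2) gives an injection h from the
   sets of positions of size i to the paired sets of size i with advice in [E];
   s A is any permutation moving A to the paired set chosen by h A. *)
Lemma paired_coding k : exists (h : {set 'I_k * bool + unit} ->
      {set 'I_k} * bool * 'I_(4 * k.+1 * 2 ^ k))
    (s : {set 'I_k * bool + unit} -> {perm 'I_k * bool + unit}),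
  injective h /\
  forall A p, (s A p \in paired_set (h A).1.1 (h A).1.2) = (p \in A).
Proof.
set T := ('I_k * bool + unit)%type; set E := 4 * k.+1 * 2 ^ k.
have cT : #|{: T}| = (2 * k).+1.
  by rewrite card_sum card_prod card_bool card_unit card_ord; lia.
have [i|h h_inj hP] := @fiberwise_injection {set T}
    ({set 'I_k} * bool * 'I_E)%type _ (fun A => #|A|) (fun y => #|paired_set y.1.1 y.1.2|).
  rewrite card_draws cT; apply: leq_trans (bin_odd_leq _ _) _.
  pose Z := setX (setX [set A : {set 'I_k} | #|A| == i./2] [set odd i]) [set: 'I_E].
  apply: (@leq_trans #|Z|).
    by rewrite !cardsX card_draws cards1 cardsT !card_ord muln1 mulnC.
  apply/subset_leq_card/subsetP => -[[A b] e]; rewrite !inE /= andbT.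
  by case/andP => /eqP cA /eqP->; rewrite card_paired_set cA; lia.
suff [s sP] : exists s : {set T} -> {perm T},
    forall A p, (s A p \in paired_set (h A).1.1 (h A).1.2) = (p \in A).
  by exists h, s.
suff : forall A : {set T}, exists s : {perm T},
    forall p, (s p \in paired_set (h A).1.1 (h A).1.2) = (p \in A).
  by move/fin_all_exists.
by move=> A; apply: perm_onto_set; rewrite hP.
Qed.

(** The code of a word consists of the [gG]-values of its rearranged pairs, the single letter and
    the advice. The decoder gets the pairs from [gF], reads one colour per pair and that of the
    single letter, and with the advice recovers [h A], hence [A]. It can fail only if [gF] does not
    undo [gG] on some pair, and that pair is monochromatic. *)
Lemma dual_amgm_lossy_retract N m k
    (d := (2 * k).+1 * (2 * up_log 2 (2 * N) + up_log 2 m + 1)) :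
  0 < N -> 0 < m ->
  lossy_retract (dual_amgm_problem N m)
    ({ffun 'I_k -> 'I_m} * 'I_(2 * N) * 'I_(4 * k.+1 * 2 ^ k))%type
    {ffun 'I_k * bool + unit -> 'I_(2 * N)}
    d d.
Proof.
move=> N_gt0 m_gt0; set E := 4 * k.+1 * 2 ^ k; pose P := dual_amgm_problem N m.
have [h [s [h_inj sP]]] := paired_coding k.
pose word := {ffun 'I_k * bool + unit -> 'I_(2 * N)}.
pose code := ({ffun 'I_k -> 'I_m} * 'I_(2 * N) * 'I_E)%type.
pose colours (v : word) (w : input P) := [ffun p => gC w (v p)].
pose col (c : {ffun 'I_k * bool + unit -> bool}) := [set p | c p].
pose letter (v : word) c p := v ((s (col c))^-1%g p).
pose pair_at (v : word) c i := (letter v c (inl (i, false)), letter v c (inl (i, true))).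
pose enc (v : word) c (w : input P) : code :=
  ([ffun i => gG w (pair_at v c i)], letter v c (inr tt), (h (col c)).2).
(* The [pick] inverts [h]; [set0] stands in for codes outside its image. *)
pose arrange (x : code) (q : {ffun 'I_k -> 'I_(2 * N) * 'I_(2 * N)})
    (c : {ffun 'I_k -> bool}) (b : bool) : word :=
  let A := odflt set0 [pick A | h A == ([set i | c i], b, x.2)] in
  [ffun p => match s A p with inl (i, e) => side (q i) e | inr _ => x.1.2 end].
pose dec (x : code) (w : input P) : word :=
  let q := [ffun i => gF w (x.1.1 i)] in
  arrange x q [ffun i => gC w (q i).1] (gC w x.1.2).
pose sol (v : word) (c : {ffun 'I_k * bool + unit -> bool}) (r : {ffun 'I_k -> bool}) :
    'I_(2 * N) * 'I_(2 * N) :=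
  if [pick i | r i] is Some i then pair_at v c i else (v (inr tt), v (inr tt)).
pose wrong (v : word) c (w : input P) :=
  [ffun i => gF w (gG w (pair_at v c i)) != pair_at v c i].
have cT : #|{: 'I_k * bool + unit}| = (2 * k).+1.
  by rewrite card_sum card_prod card_bool card_unit card_ord; lia.
have ccol v : computable ((2 * k).+1 * 1) (colours v).
  by rewrite -cT; apply: computable_ffun => p; apply: computable_gC.
exists dec, (fun v w => enc v (colours v w) w),
  (fun v w => sol v (colours v w) (wrong v (colours v w) w)).
split=> [x|v|v|w v].
- apply: (@computable_weaken _ (#|'I_k| * (2 * up_log 2 (2 * N)) + (#|'I_k| * 1 + 1))).
    by rewrite card_ord /d; lia.
  apply: (@computable_bind P _ _ _ _ (fun w => [ffun i => gF w (x.1.1 i)])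
    (fun q w => arrange x q [ffun i => gC w (q i).1] (gC w x.1.2))).
    by apply: computable_ffun => i; apply: computable_gF.
  move=> q; apply: (@computable_bind P _ _ _ _ (fun w => [ffun i => gC w (q i).1])
    (fun c w => arrange x q c (gC w x.1.2))).
    by apply: computable_ffun => i; apply: computable_gC.
  by move=> c; apply: (computable_map (arrange x q c)); apply: computable_gC.
- apply: (@computable_weaken _ ((2 * k).+1 * 1 + #|'I_k| * up_log 2 m)).
    by rewrite card_ord /d; lia.
  apply: (@computable_bind P _ _ _ _ (colours v) (enc v)) => // c.
  apply: (computable_map (fun x => (x, letter v c (inr tt), (h (col c)).2))).
  by apply: computable_ffun => i; apply: computable_gG.
- apply: (@computable_weaken _ ((2 * k).+1 * 1
      + #|'I_k| * (up_log 2 m + 2 * up_log 2 (2 * N)))).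
    by rewrite card_ord /d; lia.
  apply: (@computable_bind P _ _ _ _ (colours v)
    (fun c w => sol v c (wrong v c w))) => // c.
  apply: (computable_map (sol v c)); apply: computable_ffun => i.
  apply: (@computable_bind P _ _ _ _ (fun w => gG w (pair_at v c i))
    (fun z w => gF w z != pair_at v c i)); first exact: computable_gG.
  move=> z; apply: (computable_map (fun u => u != pair_at v c i)).
  exact: computable_gF.
set c := colours v w; set A := col c.
have colour p : gC w (letter v c p) = (p \in paired_set (h A).1.1 (h A).1.2).
  by rewrite -[p in RHS](permKV (s A)) sP inE ffunE.
rewrite /sol; case: pickP => [i wrong_i|allok] ne /=.
  rewrite ffunE in wrong_i; rewrite wrong_i andbT.
  by rewrite !colour !inE.
have FG i : gF w (gG w (pair_at v c i)) = pair_at v c i.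
  by apply/eqP; have := allok i; rewrite ffunE => /negbFE.
case/eqP: ne; rewrite /dec /arrange.
set q := [ffun i => gF w _].
have qE i : q i = pair_at v c i by rewrite !ffunE FG.
have hA : ([set i | [ffun i => gC w (q i).1] i], gC w (letter v c (inr tt)), (h A).2) = h A.
  case: (h A) colour => -[psi b] e colour /=; congr (_, _, _); last first.
    by rewrite colour inE.
  by apply/setP => i; rewrite inE ffunE qE colour inE.
rewrite /enc /=; move: hA => ->.
have -> : [pick A' | h A' == h A] = Some A.
  by case: pickP => [A' /eqP/h_inj->|/(_ A)] //; rewrite eqxx.
apply/ffunP => p; rewrite ffunE /=.
have vE : v p = letter v c (s A p) by rewrite /letter permK.
by rewrite vE; case: (s A p) => [[i []]|[]] //; rewrite qE.
Qed.

(** * Parameter bounds for the graph problems *)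

(** For [L >= 2], [a <= L ^ a] and [L.+1 <= L ^ 2]; the summand [k] covers [L = 0] and [L = 1]. *)
Lemma poly_leq_polylog a b : exists k, forall L, a * L.+1 ^ b <= L ^ k + k.
Proof.
exists (a * 2 ^ b + (a + 2 * b)) => -[|[|L]].
- by rewrite exp1n muln1; apply: leq_trans (leq_addl _ _); rewrite addnCA leq_addr.
- by apply: leq_trans (leq_addl _ _); rewrite leq_addr.
apply: leq_trans (leq_addr _ _); apply: (@leq_trans (L.+2 ^ (a + 2 * b))); last first.
  by rewrite leq_pexp2l // leq_addl.
rewrite expnD expnM; apply: leq_mul; last first.
  by case: b => // b; rewrite leq_exp2r // -mulnn; nia.
apply: leq_trans (ltnW (ltn_expl a (ltnSn 1))) _.
by case: a => // a; rewrite leq_exp2r.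
Qed.

Lemma dt_reducibleI (A B : search_family) a b :
  (forall i : idx A, exists (j : idx B) d, reduction (member i) (member j) d /\
     up_log 2 (input_length (member j)) + d
       <= a * (up_log 2 (input_length (member i))).+1 ^ b) ->
  dt_reducible A B.
Proof.
move=> H; have [k kP] := poly_leq_polylog a b; exists k => i.
have [j [d [red le]]] := H i; exists j, d; split=> //.
exact: leq_trans le (kP _).
Qed.

(** Some indices admit no legal input, for instance when [m = 0] in the dual problem, but must still
    be reduced. *)
Lemma reduction_empty (P Q : problem) d :
  (input P -> False) -> solution P -> reduction P Q d.
Proof.
move=> P0 x0; exists (fun w => False_rect _ (P0 w)), (fun=> Leaf _ false),
  (fun=> Leaf _ x0); split=> // w; case: (P0 w).
Qed.

Lemma lossy_length_leq M e :
  M <= 2 ^ e -> up_log 2 (input_length (lossy_problem M)) <= 2 * e + 2.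
Proof.
move=> le; apply: up_log_min => //.
rewrite /input_length card_sum !card_prod !card_ord.
have u1 : up_log 2 (2 * M) <= e.+1 by apply: up_log_min; rewrite // expnS leq_mul2l.
have u2 : up_log 2 M <= e by apply: up_log_min.
have lt_e : e < 2 ^ e by apply: ltn_expl.
have -> : 2 ^ (2 * e + 2) = 2 ^ e * (2 ^ e * 4) by rewrite expnD mul2n -addnn expnD mulnA.
rewrite -mulnA mulnCA -mulnDr; apply: leq_mul => //; lia.
Qed.

Lemma lossy_length_geq M :
  0 < M -> up_log 2 M <= up_log 2 (input_length (lossy_problem M)).
Proof.
move=> M_gt0; apply: leq_up_log; rewrite /input_length card_sum !card_prod !card_ord.
have : 0 < up_log 2 (2 * M) by rewrite up_log_gt0 //; lia.
nia.
Qed.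

Lemma graph_length_leq N m a b : N <= 2 ^ a -> m <= 2 ^ b ->
  up_log 2 #|graph_position N m| <= 2 * a + b + 4.
Proof.
move=> leN lem; apply: up_log_min => //.
rewrite !card_sum !card_prod card_bool !card_ord.
have u1 : up_log 2 (2 * N) <= a.+1 by apply: up_log_min; rewrite // expnS leq_mul2l.
have u2 : up_log 2 m <= b by apply: up_log_min.
have lt_a : a < 2 ^ a by apply: ltn_expl.
have lt_b : b < 2 ^ b by apply: ltn_expl.
have -> : 2 ^ (2 * a + b + 4) = 16 * (2 ^ a * 2 ^ a * 2 ^ b).
  by rewrite (expnD _ (2 * a + b)) (expnD _ (2 * a)) mul2n -addnn expnD mulnC.
have l1 : N <= 2 ^ a * 2 ^ a * 2 ^ b.
  by apply: leq_trans leN _; rewrite -mulnA leq_pmulr // muln_gt0 !expn_gt0.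
have l2 : m * up_log 2 (2 * N) <= 2 ^ a * 2 ^ a * 2 ^ b.
  rewrite mulnC -mulnA; apply: leq_mul; first by lia.
  by apply: leq_trans lem _; rewrite leq_pmull // expn_gt0.
have l3 : N * N * up_log 2 m <= 2 ^ a * 2 ^ a * 2 ^ b.
  by apply: leq_mul; [apply: leq_mul | lia].
nia.
Qed.

Lemma amgm_reduction N m k (d := k * (2 * up_log 2 (2 * N) + up_log 2 m + 2)) :
  0 < N -> 0 < m -> 2 * (2 * k).+1 * N ^ (2 * k) <= m ^ k ->
  reduction (amgm_problem N m) (lossy_problem ((2 * N) ^ (2 * k))) d.
Proof.
move=> N_gt0 m_gt0 le.
have := lossy_retract_reduction (amgm_lossy_retract k N_gt0 m_gt0).
rewrite maxnn card_prod !card_ffun card_prod card_bool card_sig !card_ord.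
rewrite (mulnC k 2); apply; first by rewrite expn_gt0; lia.
have -> : #|[pred x : {set 'I_k * bool} | #|x| == k]| = 'C(2 * k, k).
  have := card_draws ('I_k * bool)%type k.
  by rewrite card_prod card_bool card_ord mulnC cardsE => <-.
(* The factor [(2 * k).+1] in [le] pays for the loss in [central_bin_lower]. *)
apply: leq_trans (leq_mul le (leqnn _)); rewrite expnMn.
have := central_bin_lower k; move: ('C(2 * k, k)) => C; nia.
Qed.

Lemma dual_amgm_reduction N m k
    (d := (2 * k).+1 * (2 * up_log 2 (2 * N) + up_log 2 m + 1)) :
  0 < N -> 8 * k.+1 * m ^ k <= 2 ^ k * N ^ (2 * k) ->
  exists2 M, 0 < M <= (2 * N) ^ (2 * k).+1 &
    reduction (dual_amgm_problem N m) (lossy_problem M) d.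
Proof.
move=> N_gt0 le; have [m0|m_gt0] := posnP m.
  exists 1; first by rewrite expn_gt0; lia.
  have v : 'I_(2 * N) by exists 0; lia.
  apply: reduction_empty; last exact: (v, v).
  by rewrite /= m0 => w; case: (gG w (v, v)).
have := lossy_retract_reduction (dual_amgm_lossy_retract k N_gt0 m_gt0).
rewrite maxnn; set S := #|_|; rewrite card_ffun card_sum card_prod card_bool card_unit.
rewrite !card_ord (mulnC k 2) addn1 => red.
have S_gt0 : 0 < S.
  by rewrite /S !card_prod card_ffun !card_ord !muln_gt0 !expn_gt0; lia.
have leS : 2 * S <= (2 * N) ^ (2 * k).+1.
  rewrite /S !card_prod card_ffun !card_ord expnSr expnMn.
  have -> : 2 ^ (2 * k) = 2 ^ k * 2 ^ k by rewrite mulnC expnM mulnn.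
  move: (2 ^ k) (N ^ _) (m ^ k) le => x y z le.
  have := leq_mul le (leqnn (x * (2 * N))); lia.
exists S; last exact: red.
by rewrite S_gt0; lia.
Qed.

Lemma graph_card_geq N m : 2 * N <= #|graph_position N m|.
Proof. by rewrite !card_sum card_ord; lia. Qed.

Lemma card_eq_cancel (S T : finType) : #|S| = #|T| ->
  exists (f : S -> T) (g : T -> S), cancel f g /\ cancel g f.
Proof.
move=> eqST.
exists (fun x => enum_val (cast_ord eqST (enum_rank x))),
  (fun y => enum_val (cast_ord (esym eqST) (enum_rank y))).
by split=> x; rewrite enum_valK ?cast_ordK ?cast_ordKV enum_rankK.
Qed.

(** [gF] always returns a vertex of colour 0 and one of colour 1, so a solution can only be a moving
    point of ['I_m]. *)
Lemma reduction_amgm P N m d e :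
  lossy_retract P ('I_N * 'I_N)%type 'I_m d e ->
  reduction P (amgm_problem N m) (maxn d e).
Proof.
move=> [f [g [s [cf cg cs H]]]].
have [|v [v' [vK v'K]]] := @card_eq_cancel (bool * 'I_N)%type 'I_(2 * N).
  by rewrite card_prod card_bool !card_ord.
pose F (w : input P) : input (amgm_problem N m) :=
  GraphInput (fun u => (v' u).1) (fun x => (v (false, (g x w).1), v (true, (g x w).2)))
    (fun u => f ((v' u.1).2, (v' u.2).2) w).
apply: (@reductionI _ (amgm_problem N m) _ F s) => [p|x|w x].
- case: p => [[u|[[x b] c]]|[[u1 u2] c]] /=.
  + exact: computable_const.
  + apply: (computable_map (fun y : 'I_N * 'I_N => bit (if b
        then v (true, y.2) else v (false, y.1)) c)).
    by apply: computable_weaken (cg x); rewrite leq_maxl.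
  + apply: (computable_map (fun x : 'I_m => bit x c)).
    by apply: computable_weaken (cf _); rewrite leq_maxl.
- by apply: computable_weaken (cs x); rewrite leq_maxr.
by rewrite /= !vK /= orbF -surjective_pairing; apply: H.
Qed.

(** With [N] vertices of each colour, the monochromatic pairs are the points of
    [bool * ('I_N * 'I_N)]. [gG] takes the colour of the first vertex, which loses nothing on such
    pairs. *)
Lemma reduction_dual_amgm P N m d e :
  lossy_retract P 'I_m (bool * ('I_N * 'I_N))%type d e ->
  reduction P (dual_amgm_problem N m) (maxn d e).
Proof.
move=> [f [g [s [cf cg cs H]]]].
have [|v [v' [vK v'K]]] := @card_eq_cancel (bool * 'I_N)%type 'I_(2 * N).
  by rewrite card_prod card_bool !card_ord.
pose y (u : 'I_(2 * N) * 'I_(2 * N)) := ((v' u.1).1, ((v' u.1).2, (v' u.2).2)).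
pose uv (z : bool * ('I_N * 'I_N)) := (v (z.1, z.2.1), v (z.1, z.2.2)).
pose F (w : input P) : input (dual_amgm_problem N m) :=
  GraphInput (fun u => (v' u).1) (fun x => uv (f x w)) (fun u => g (y u) w).
apply: (@reductionI _ (dual_amgm_problem N m) _ F (fun u => s (y u))) => [p|x|w x].
- case: p => [[u|[[x b] c]]|[[u1 u2] c]] /=.
  + exact: computable_const.
  + apply: (computable_map (fun z => bit (if b then (uv z).2 else (uv z).1) c)).
    by apply: computable_weaken (cf x); rewrite leq_maxl.
  + apply: (computable_map (fun x : 'I_m => bit x c)).
    by apply: computable_weaken (cg _); rewrite leq_maxl.
- by apply: computable_weaken (cs _); rewrite leq_maxr.
case: x => u1 u2 /= /andP[/eqP eqC ne]; apply: H; apply: contraNneq ne => ->.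
rewrite /uv /y /= -surjective_pairing eqC -surjective_pairing.
by rewrite !v'K.
Qed.

(** * Growth of exponentials and rounding *)

Section Reals.
Local Open Scope ring_scope.

(** Bernoulli's inequality bounds [c ^ t.+1] below by a linear function of [t]; its square is
    quadratic and beats the linear side. *)
Lemma exp_beats_linear (R : realType) (c K : R) :
  1 < c -> exists k : nat, K * k.+1%:R <= c ^+ k.
Proof.
move=> c_gt1; pose x := c - 1; have x_gt0 : 0 < x by rewrite subr_gt0.
have cE : c = 1 + x by rewrite /x addrC subrK.
have bern t : 1 + x *+ t <= c ^+ t.
  elim: t => [|t IHt]; first by rewrite mulr0n addr0 expr0.
  rewrite exprS; apply: le_trans (ler_wpM2l _ IHt); last by lra.
  rewrite cE mulrS; have : 0 <= x * (x *+ t) by rewrite mulr_ge0 ?mulrn_wge0 // ltW.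
  lra.
(* The 3 comes from [2 * T + 1 <= 3 * T] for [T = t.+1]. *)
have [t tP] : exists t : nat, 3 * `|K| / x ^+ 2 < t.+1%:R.
  by exists (Num.truncn (3 * `|K| / x ^+ 2)); apply: truncnS_gt.
exists (t.+1 * 2)%N; rewrite exprM.
have le1 : (x * t.+1%:R) ^+ 2 <= (c ^+ t.+1) ^+ 2.
  rewrite ler_sqr ?nnegrE; last 2 first.
  - by rewrite mulr_ge0 // ltW.
  - by rewrite exprn_ge0 //; lra.
  by apply: le_trans (bern _); rewrite mulr_natr; lra.
apply: le_trans le1; move: tP; rewrite ltr_pdivrMr ?exprn_gt0 // => tP.
have T1 : 1 <= t.+1%:R :> R by rewrite ler1n.
have -> : (t.+1 * 2).+1%:R = 2 * t.+1%:R + 1 :> R.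
  by rewrite -natr1 natrM mulrC.
move: (t.+1%:R : R) tP T1 => T tP T1; rewrite exprMn expr2 -mulrA.
apply: (@le_trans _ _ (`|K| * (3 * T))).
  apply: (@le_trans _ _ (`|K| * (2 * T + 1))).
    by rewrite ler_wpM2r ?ler_norm //; lra.
  by rewrite ler_wpM2l //; lra.
have -> : x * (x * T ^+ 2) = (T * x ^+ 2) * T by ring.
have -> : `|K| * (3 * T) = (3 * `|K|) * T by ring.
by rewrite ler_wpM2r //; lra.
Qed.

Lemma natr_absz_ceil (R : realType) (x : R) :
  0 <= x -> `|Num.ceil x|%N%:R = (Num.ceil x)%:~R :> R.
Proof.
move=> x_ge0; rewrite natr_absz ger0_norm //.
by rewrite ceil_ge0; lra.
Qed.

Lemma absz_ceil_ge (R : realType) (x : R) : 0 <= x -> x <= `|Num.ceil x|%N%:R.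
Proof. by move=> x_ge0; rewrite natr_absz_ceil // ceil_ge. Qed.

Lemma absz_ceil_leq (R : realType) (x : R) n :
  0 <= x <= n%:R -> (`|Num.ceil x|%N <= n)%N.
Proof.
case/andP=> x_ge0 le; rewrite -(ler_nat R) natr_absz_ceil //.
by rewrite -[n%:R]/(n%:Z%:~R) ler_int ceil_le_int.
Qed.

End Reals.

(** * Reductions between Lossy-Code and the graph problems *)

Lemma amgm_ceil_leq (R : realType) (c : R) N : (0 <= c)%R ->
  `|Num.ceil (c * N%:R ^+ 2)%R| <= `|Num.ceil c| * N ^ 2.
Proof.
move=> c_ge0; apply: absz_ceil_leq.
by rewrite mulr_ge0 ?exprn_ge0 //= natrM natrX ler_wpM2r ?exprn_ge0 ?absz_ceil_ge.
Qed.

Lemma amgm_to_lossy (R : realType) (c : R) :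
  (1 < c)%R -> dt_reducible (amgm_lc c) lossy_code.
Proof.
(* [4 * k.+1] dominates the [2 * (2 * k).+1] required by [amgm_reduction]; [k] depends on [c]
   only. *)
move=> c_gt1; have [k kP] := exp_beats_linear 4%:R c_gt1.
pose c0 := `|Num.ceil c|.
apply: (@dt_reducibleI _ _ (4 * k + 2 + k * (4 + c0)) 1) => -[N N_gt0] /=.
set m := `|Num.ceil _|.
have cN_ge0 : (0 <= c * N%:R ^+ 2)%R by rewrite mulr_ge0 ?exprn_ge0 //; lra.
have le_m : (c * N%:R ^+ 2 <= m%:R)%R by apply: absz_ceil_ge.
have N1 : (1 <= N%:R :> R)%R by rewrite ler1n.
have m_gt0 : 0 < m.
  rewrite -(ltr_nat R); apply: lt_le_trans le_m.
  by rewrite mulr_gt0 ?exprn_gt0 //; lra.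
have le : 2 * (2 * k).+1 * N ^ (2 * k) <= m ^ k.
  rewrite -(ler_nat R) !natrM !natrX exprM.
  apply: (@le_trans _ _ ((c * N%:R ^+ 2) ^+ k)%R); last first.
    by rewrite lerXn2r ?nnegrE.
  rewrite (exprMn k c) ler_wpM2r ?exprn_ge0 //; apply: le_trans kP.
  by rewrite -!natrM ler_nat; lia.
have M_gt0 : 0 < (2 * N) ^ (2 * k) by rewrite expn_gt0; lia.
exists (exist (fun M => 0 < M) _ M_gt0); exists (k * (2 * up_log 2 (2 * N) + up_log 2 m + 2)).
split; first exact: amgm_reduction.
set L := up_log 2 (input_length (amgm_problem _ _)); rewrite expn1 /=.
have leN : 2 * N <= 2 ^ L.
  by apply: leq_trans (graph_card_geq N m) _; apply: up_logP.
have uN : up_log 2 (2 * N) <= L by apply: up_log_min.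
have um : up_log 2 m <= c0 + 2 * L.
  apply: up_log_min => //; apply: (@leq_trans (c0 * N ^ 2)).
    by apply: amgm_ceil_leq; lra.
  rewrite expnD; apply: leq_mul; first exact: ltnW (ltn_expl _ _).
  by rewrite mulnC expnM leq_exp2r //; lia.
have lM : (2 * N) ^ (2 * k) <= 2 ^ (L * (2 * k)).
  by rewrite [2 ^ (L * _)]expnM; case: (2 * k) => // j; rewrite leq_exp2r.
have := lossy_length_leq lM; set U := up_log 2 (input_length _) => le_U.
have : k * (2 * up_log 2 (2 * N) + up_log 2 m + 2) <= k * (4 * L + c0 + 2).
  by rewrite leq_mul2l; apply/orP; right; lia.
nia.
Qed.

(** Bounds the cost of [c + v] doublings, [v] being logarithmic in the size. *)
Lemma amplification_depth_leq c v u L (d := maxn ((c + v) * u) ((c + v).+1 * ((c + v).+2 * u))) :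
  v <= L -> u <= L.+1 -> d <= (c + 3) ^ 3 * L.+1 ^ 3.
Proof.
move=> le_v le_u; have -> : d = (c + v).+1 * ((c + v).+2 * u).
  apply/maxn_idPr; rewrite mulnA leq_mul2r; apply/orP; right.
  by rewrite -[X in X <= _]muln1; apply: leq_mul; lia.
rewrite -expnMn !expnS expn0 muln1.
have le3 : (c + v).+2 <= (c + 3) * L.+1 by nia.
apply: leq_mul; first exact: leq_trans (leqnSn _) le3.
by apply: leq_mul => //; apply: leq_trans le_u _; rewrite leq_pmull // addn_gt0 orbT.
Qed.

Lemma lossy_to_amgm (R : realType) (c : R) :
  (1 < c)%R -> dt_reducible lossy_code (amgm_lc c).
Proof.
move=> c_gt1; pose c0 := `|Num.ceil c|.
apply: (@dt_reducibleI _ _ (c0 + 4 + (c0 + 3) ^ 3) 3) => -[M M_gt0] /=.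
(* With [N = M], about [c * M ^ 2] points must be reached from [M]; [c0 + v] doublings suffice since
   [M <= 2 ^ v]. *)
exists (exist (fun M => 0 < M) M M_gt0) => /=.
set m := `|Num.ceil _|; set u := up_log 2 (2 * M); set v := up_log 2 M.
have cM_ge0 : (0 <= c * M%:R ^+ 2)%R by rewrite mulr_ge0 ?exprn_ge0 //; lra.
have m_gt0 : 0 < m.
  rewrite -(ltr_nat R); apply: lt_le_trans (absz_ceil_ge cM_ge0).
  by rewrite mulr_gt0 ?exprn_gt0 ?ltr0n //; lra.
have leM : M <= 2 ^ v by apply: up_logP.
have lec : c0 <= 2 ^ c0 by apply: ltnW (ltn_expl _ _).
have le_m : m <= 2 ^ (c0 + v) * M.
  apply: leq_trans (amgm_ceil_leq _ _) _; first by lra.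
  rewrite expnD -mulnA; apply: leq_mul => //.
  by rewrite -mulnn leq_mul2r leM orbT.
exists (maxn ((c0 + v) * u) ((c0 + v).+1 * ((c0 + v).+2 * u))); split.
  apply: reduction_amgm; apply: lossy_retract_lossy.
    by rewrite card_prod card_ord M_gt0 /=; nia.
  by rewrite card_ord m_gt0.
set L := up_log 2 (input_length (lossy_problem M)).
have le_v : v <= L by apply: lossy_length_geq.
have le_u : u <= L.+1.
  apply: up_log_min => //; rewrite expnS leq_mul2l /=.
  by apply: leq_trans leM _; rewrite leq_exp2l.
have le_m2 : m <= 2 ^ (c0 + v + v).
  by apply: leq_trans le_m _; rewrite (expnD _ (c0 + v)) leq_mul2l leM orbT.
have := graph_length_leq leM le_m2.
rewrite -[#|_|]/(input_length (amgm_problem M m)); set U := up_log 2 (input_length _) => le_U.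
rewrite [X in _ <= X]mulnDl; apply: leq_add; last exact: amplification_depth_leq.
apply: leq_trans le_U _; apply: (@leq_trans ((c0 + 4) * L.+1)).
  by rewrite mulnS; nia.
by rewrite leq_mul2l -[X in X <= _]expn1 leq_pexp2l ?orbT.
Qed.

Lemma dual_amgm_to_lossy (R : realType) (c : R) :
  (0 < c)%R -> (c < 2)%R -> dt_reducible (dual_amgm_lc c) lossy_code.
Proof.
move=> c_gt0 c_lt2.
have c2_gt1 : (1 < 2 / c)%R by rewrite ltr_pdivlMr // mul1r.
(* As [m <= c * N ^ 2], the condition of [dual_amgm_reduction] follows from
   [8 * k.+1 <= (2 / c) ^ k]. *)
have [k kP] := exp_beats_linear 8%:R c2_gt1.
apply: (@dt_reducibleI _ _ (2 * (2 * k).+1 + 2 + (2 * k).+1 * 4) 1) => -[N N_gt0] /=.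
set m := Num.truncn _.
have cN_ge0 : (0 <= c * N%:R ^+ 2)%R by rewrite mulr_ge0 ?exprn_ge0 //; lra.
have le_m : (m%:R <= c * N%:R ^+ 2)%R by rewrite truncn_le.
have le : 8 * k.+1 * m ^ k <= 2 ^ k * N ^ (2 * k).
  rewrite -(ler_nat R) !natrM !natrX exprM.
  apply: (@le_trans _ _ (8%:R * k.+1%:R * (c * N%:R ^+ 2) ^+ k)%R).
    by rewrite ler_wpM2l ?mulr_ge0 // lerXn2r ?nnegrE.
  rewrite (exprMn k c) mulrA ler_wpM2r ?exprn_ge0 //.
  by move: kP; rewrite expr_div_n ler_pdivlMr ?exprn_gt0.
have [M /andP[M_gt0 leM] red] := dual_amgm_reduction N_gt0 le.
exists (exist (fun M => 0 < M) _ M_gt0).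
exists ((2 * k).+1 * (2 * up_log 2 (2 * N) + up_log 2 m + 1)).
split; first exact: red.
set L := up_log 2 (input_length (dual_amgm_problem _ _)); rewrite expn1 /=.
have leN : 2 * N <= 2 ^ L.
  by apply: leq_trans (graph_card_geq N m) _; apply: up_logP.
have uN : up_log 2 (2 * N) <= L by apply: up_log_min.
have um : up_log 2 m <= 2 * L.
  apply: up_log_min => //; apply: (@leq_trans ((2 * N) ^ 2)).
    rewrite -(ler_nat R); apply: le_trans le_m _.
    rewrite natrX natrM exprMn ler_wpM2r ?exprn_ge0 //; lra.
  by rewrite (mulnC 2 L) expnM leq_exp2r.
have lM : M <= 2 ^ (L * (2 * k).+1).
  by apply: leq_trans leM _; rewrite [2 ^ (L * _)]expnM leq_exp2r.
have := lossy_length_leq lM; set U := up_log 2 (input_length _) => le_U.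
have : (2 * k).+1 * (2 * up_log 2 (2 * N) + up_log 2 m + 1) <= (2 * k).+1 * (4 * L + 1).
  by rewrite leq_mul2l; apply/orP; right; lia.
nia.
Qed.

Lemma lossy_to_dual_amgm (R : realType) (c : R) :
  (0 < c)%R -> (c < 2)%R -> dt_reducible lossy_code (dual_amgm_lc c).
Proof.
(* As [c] may be small, [N = t * M] with [c * t >= 1] is used, so that [m] is at least [M]. *)
move=> c_gt0 c_lt2; pose t := (Num.truncn c^-1).+1.
have ct : (1 <= c * t%:R)%R.
  by rewrite -ler_pdivrMl // mulr1 ltW // truncnS_gt.
have [c0 c0E] : exists c0, c0 = 4 * t ^ 2 by exists (4 * t ^ 2).
apply: (@dt_reducibleI _ _ (2 * t + c0 + 4 + (c0 + 3) ^ 3) 3) => -[M M_gt0] /=.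
have N_gt0 : 0 < t * M by rewrite muln_gt0.
exists (exist (fun M => 0 < M) _ N_gt0) => /=.
set m := Num.truncn _; set u := up_log 2 (2 * M); set v := up_log 2 M.
have M1 : (1 <= M%:R :> R)%R by rewrite ler1n.
have cM_ge0 : (0 <= c * (t * M)%:R ^+ 2)%R by rewrite mulr_ge0 ?exprn_ge0 //; lra.
have leMm : M <= m.
  rewrite truncn_ge_nat // natrM exprMn mulrA !expr2 mulrA.
  have T1 : (1 <= t%:R :> R)%R by rewrite ler1n.
  have : (1 <= c * t%:R * t%:R)%R by nra.
  move=> ct1; apply: (@le_trans _ _ (M%:R * M%:R)%R); first by rewrite ler_peMr //; lra.
  by rewrite -[X in (_ <= X)%R]mulrA ler_peMl ?mulr_ge0 // mulrA.
have leM : M <= 2 ^ v by apply: up_logP.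
have lec : c0 <= 2 ^ c0 by apply: ltnW (ltn_expl _ _).
have le_B : 4 * (t * M) ^ 2 <= 2 ^ (c0 + v) * M.
  rewrite expnD -mulnA expnMn mulnA -c0E; apply: leq_mul => //.
  by rewrite -mulnn leq_mul2r leM orbT.
exists (maxn ((c0 + v) * u) ((c0 + v).+1 * ((c0 + v).+2 * u))); split.
  apply: reduction_dual_amgm; apply: lossy_retract_lossy.
    by rewrite card_ord M_gt0.
  by rewrite !card_prod card_bool card_ord; nia.
set L := up_log 2 (input_length (lossy_problem M)).
have le_v : v <= L by apply: lossy_length_geq.
have le_u : u <= L.+1.
  apply: up_log_min => //; rewrite expnS leq_mul2l /=.
  by apply: leq_trans leM _; rewrite leq_exp2l.
have le_N : t * M <= 2 ^ (t + v).
  by rewrite expnD; apply: leq_mul => //; apply: ltnW (ltn_expl _ _).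
have le_m2 : m <= 2 ^ (c0 + v + v).
  apply: (@leq_trans (4 * (t * M) ^ 2)); last first.
    by apply: leq_trans le_B _; rewrite (expnD _ (c0 + v)) leq_mul2l leM orbT.
  rewrite -(ler_nat R); apply: (@le_trans _ _ (c * (t * M)%:R ^+ 2)%R).
    by rewrite truncn_le.
  by rewrite (natrM _ 4) (natrX _ (t * M)) ler_wpM2r ?exprn_ge0 //; lra.
have := graph_length_leq le_N le_m2.
rewrite -[#|_|]/(input_length (dual_amgm_problem (t * M) m)).
set U := up_log 2 (input_length _) => le_U.
rewrite [X in _ <= X]mulnDl; apply: leq_add; last exact: amplification_depth_leq.
apply: leq_trans le_U _; apply: (@leq_trans ((2 * t + c0 + 4) * L.+1)).
  by rewrite mulnS; nia.
by rewrite leq_mul2l -[X in X <= _]expn1 leq_pexp2l ?orbT.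
Qed.

(** * Inclusion-exclusion *)

Lemma card_opair_leq l : #|opair l| <= l * l.
Proof. by rewrite card_sig -[l in l * _]card_ord -[X in _ * X]card_ord -card_prod max_card. Qed.

Lemma opair1_false (p : opair 1) : False.
Proof. by case: p => -[i j] /=; rewrite !ord1 ltnn. Qed.

Lemma notin_not_retract a N (f : 'I_a -> 'I_N) (g : 'I_N -> 'I_(maxn a 1)) x (y : 'I_a) :
  val (g x) = val y -> not_retract f g x = (f y != x).
Proof. by rewrite /not_retract => ->; rewrite valK. Qed.

(** * Lossy-Code to Inclusion-Exclusion *)

Section LossyToIE.
Local Notation a1 M := (fun _ : 'I_1 => @ord_max (4 * M)).
Local Notation a2 M := (fun _ : opair 1 => @ord0 (4 * M)).

Lemma atilde_single (R : realType) M : atilde R (a1 M) (a2 M) = (4 * M)%:R%R.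
Proof.
rewrite /atilde sumr_const card_ord mulr1n (big1 (op := +%R)) ?subr0 //.
Qed.

Lemma ie_size_single (R : realType) M : ie_size (2%:R^-1 : R)%R (a1 M) (a2 M) = 2 * M.
Proof.
rewrite /ie_size atilde_single.
have -> : ((4 * M)%:R - 2%:R^-1 * (4 * M)%:R = (2 * M)%:R :> R)%R.
  by rewrite !natrM; field.
by rewrite natrK.
Qed.

Lemma ie_ge_single (R : realType) M :
  (2%:R^-1 * (4 * M)%:R <= atilde R (a1 M) (a2 M))%R.
Proof.
rewrite atilde_single; have : (0 <= (4 * M)%:R :> R)%R by [].
by lra.
Qed.

(** The single set is all of [[4M]], with identity maps, so only [ieft] and [iegt] can fail. For
    [eps = 1/2] they run between [[2M]] and [[4M]]. *)
Lemma reduction_ie_single (R : realType) P M d e (x0 : solution P) :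
  lossy_retract P 'I_(2 * M) 'I_(4 * M) d e ->
  reduction P (ie_problem (4 * M) 1 (2%:R^-1 : R)%R) (maxn d e).
Proof.
move=> [f [g [s [cf cg cs H]]]].
have E := ie_size_single R M.
have E0 (x : 'I_(@ord0 (4 * M))) : False by case: x.
pose F (w : input P) : input (ie_problem (4 * M) 1 (2%:R^-1 : R)%R) :=
  @IEInput R (4 * M) 1 (2%:R^-1)%R (fun _ _ => true) (a1 M) (a2 M) (ie_ge_single R M)
    (fun _ x => x) (fun _ x => widen_ord (leq_maxl _ _) x)
    (fun _ x => False_rect _ (E0 x)) (fun _ _ => Ordinal (leq_maxr 0 1))
    (fun x => f (cast_ord E x) w)
    (fun y => widen_ord (leq_maxl _ _) (cast_ord (esym E) (g y w))).
pose sol (x : ie_solution (4 * M) 1) (w : input P) : solution P :=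
  if x is inr y then s y w else x0.
apply: (@reductionI _ (ie_problem (4 * M) 1 (2%:R^-1 : R)%R) _ F sol) => [p|[[]|y]|w].
- case: p => [[[[[[[i x]|[i b]]|[p b]]|[[[i|p] x] b]]|[[[i|p] x] b]]|[x b]]|[x b]] /=;
    try exact: computable_const.
    rewrite /pad_bit; case: insub => [y|]; last exact: computable_const.
    apply: (computable_map (fun z : 'I_(4 * M) => bit z b)).
    by apply: computable_weaken (cf _); rewrite leq_maxl.
  apply: (computable_map (fun z : 'I_(2 * M) => bit z b)).
  by apply: computable_weaken (cg _); rewrite leq_maxl.
- by move=> ?; apply: computable_const.
- by move=> ?; apply: computable_const.
- by apply: computable_weaken (cs y); rewrite leq_maxr.
case=> [[[i x]|[p x]]|y] /=.
- by case: insubP => //= y _ _; rewrite eqxx.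
- by case: (opair1_false p).
rewrite (@notin_not_retract _ _ _ _ _ (cast_ord (esym E) (g y w))) //.
by case/andP => ne _; apply: H; move: ne; rewrite cast_ordKV.
Qed.
End LossyToIE.

Lemma ie_length_single_leq N a : 0 < N <= 2 ^ a ->
  up_log 2 #|ie_position N 1| <= 2 * a + 5.
Proof.
case/andP => N_gt0 leN; apply: up_log_min => //.
rewrite /ie_position !card_sum !card_prod !card_sum !card_ord.
have lt_up K : 0 < K -> up_log 2 K < K.+1.
  by move=> K_gt0; rewrite ltnS; apply: up_log_min => //; apply/ltnW/ltn_expl.
have u1 : up_log 2 N.+1 <= N.
  by apply: up_log_min => //; apply: ltn_expl.
have u2 : up_log 2 N <= N by apply: leq_trans u1; apply: leq_up_log.
have o0 : #|opair 1| = 0.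
  by apply: eq_card0 => p; case: (opair1_false p).
rewrite o0 mul0n !addn0 !mul1n.
apply: (@leq_trans (N * N * 32)).
  by have := leq_mul (leqnn N) u2; nia.
by rewrite expnD mul2n -addnn expnD; apply: leq_mul => //; apply: leq_mul.
Qed.

Lemma lossy_to_ie (R : realType) k :
  0 < k -> dt_reducible lossy_code (inclusion_exclusion R k).
Proof.
move=> k_gt0; apply: (@dt_reducibleI _ _ 30 1) => -[M M_gt0] /=.
have N_gt0 : 0 < 4 * M by lia.
have up2 : 2 <= up_log 2 (4 * M).
  by rewrite -[X in X <= _](@up_expnK 2 2) //; apply: leq_up_log; lia.
have pl : 3 <= polylog k (4 * M).
  rewrite /polylog; have : 2 ^ 1 <= up_log 2 (4 * M) ^ k.
    by apply: (@leq_trans (2 ^ k)); [rewrite leq_exp2l | rewrite leq_exp2r].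
  lia.
have l_le : 1 <= polylog k (4 * M) by lia.
have eps_gt : ((polylog k (4 * M))%:R^-1 < 2%:R^-1 :> R)%R.
  by rewrite ltf_pV2 ?posrE ?ltr0n ?ltr_nat //; lia.
exists (IEIndex N_gt0 l_le eps_gt) => /=; set u := up_log 2 (2 * M).
exists (maxn (2 * u) (3 * (4 * u))); split.
  have M2 : 0 < 2 * M by lia.
  apply: (@reduction_ie_single R (lossy_problem M) _ _ _ (Ordinal M2)).
  (* Two doublings reach [4 * M] points from [M]; the small side is then enlarged to [2 * M]. *)
  by apply: (@lossy_retract_lossy M 2); rewrite card_ord; lia.
set L := up_log 2 (input_length (lossy_problem M)); rewrite expn1.
have le_v : up_log 2 M <= L by apply: lossy_length_geq.
have leM : M <= 2 ^ L by apply: leq_trans (@up_logP 2 M isT) _; rewrite leq_exp2l.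
have le_u : u <= L.+1.
  by apply: up_log_min => //; rewrite expnS leq_mul2l.
have leN : 0 < 4 * M <= 2 ^ (L + 2).
  by rewrite N_gt0 expnD mulnC leq_mul2r leM orbT.
have := ie_length_single_leq leN.
rewrite -[#|_|]/(input_length (ie_problem (4 * M) 1 (2%:R^-1 : R)%R)).
set U := up_log 2 (input_length (ie_problem _ _ _)).
have -> : maxn (2 * u) (3 * (4 * u)) = 12 * u by lia.
lia.
Qed.

(** * Inclusion-Exclusion to Lossy-Code: blocks and padded maps *)

Definition block_enc (I : finType) (a : I -> nat) (q : I * nat) : nat :=
  if insub q.2 is Some x
  then enum_rank (Tagged (fun i => 'I_(a i)) (x : 'I_(a q.1))) else 0.

(** Pairs and codes are plain naturals, because the block sizes are read from the input and cannot
    occur in fixed types. *)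
Definition block_dec (I : finType) (a : I -> nat) (y : nat) : option (I * nat) :=
  if insub y is Some r
  then let t := enum_val (r : 'I_#|{: {i : I & 'I_(a i)}}|) in
       Some (tag t, val (tagged t))
  else None.

Lemma card_blocks (I : finType) (a : I -> nat) :
  #|{: {i : I & 'I_(a i)}}| = \sum_i a i.
Proof.
by rewrite card_tagged sumnE big_map big_enum; apply: eq_bigr => i _; rewrite card_ord.
Qed.

Lemma block_encK (I : finType) (a : I -> nat) q :
  q.2 < a q.1 -> block_dec a (block_enc a q) = Some q.
Proof.
case: q => i x lt_x; rewrite /block_enc insubT /block_dec.
set r := enum_rank _; rewrite (valK r : insub (nat_of_ord r) = Some r) /=.
by rewrite /r enum_rankK.
Qed.

Lemma block_enc_lt (I : finType) (a : I -> nat) q :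
  q.2 < a q.1 -> block_enc a q < \sum_i a i.
Proof. by case: q => i x lt_x; rewrite /block_enc insubT -card_blocks. Qed.

Lemma block_decP (I : finType) (a : I -> nat) y q :
  block_dec a y = Some q -> q.2 < a q.1 /\ block_enc a q = y.
Proof.
rewrite /block_dec; case: insubP => // r _ <- [<-] /=; split; first exact: ltn_ord.
by rewrite /block_enc /= valK -/(Tagged _ _); case: (enum_val r) (enum_valK r) => i x /= ->.
Qed.

Lemma block_dec_None (I : finType) (a : I -> nat) y :
  block_dec a y = None -> \sum_i a i <= y.
Proof. by rewrite /block_dec; case: insubP => // lt _; rewrite leqNgt -card_blocks. Qed.

Lemma block_dec_ge (I : finType) (a : I -> nat) y :
  \sum_i a i <= y -> block_dec a y = None.
Proof. by move=> le; rewrite /block_dec insubF // card_blocks ltnNge le. Qed.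

(** With [n0 = 0] the bits of this total extension are those of [pad_bit], so they can be
    queried. *)
Definition pad_val (a N : nat) (n0 : 'I_N) (f : 'I_a -> 'I_N) (x : nat) : 'I_N :=
  if insub x is Some y then f y else n0.

Lemma bit_pad_val a N (n0 : 'I_N) (f : 'I_a -> 'I_N) x b :
  val n0 = 0 -> pad_bit f x b = bit (pad_val n0 f x) b.
Proof.
by move=> n00; rewrite /pad_bit /pad_val; case: insub => //; rewrite n00 /bit div0n.
Qed.

Lemma not_retractPn a N (n0 : 'I_N) (f : 'I_a -> 'I_N) (g : 'I_N -> 'I_(maxn a 1)) x :
  ~~ not_retract f g x -> val (g x) < a /\ pad_val n0 f (val (g x)) = x.
Proof.
rewrite /not_retract /pad_val; case: insubP => // y lt _.
by rewrite negbK => /eqP.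
Qed.

Definition first_index l (r : {ffun 'I_l -> bool}) : option 'I_l :=
  [pick i | r i && [forall j, r j ==> (i <= j)]].

Lemma first_indexP l (r : {ffun 'I_l -> bool}) i :
  r i -> exists j, [/\ first_index r = Some j, r j & j <= i].
Proof.
move=> ri; rewrite /first_index; case: pickP => [j /andP[rj /forallP min_j]|none].
  by exists j; split=> //; have /implyP := min_j i; apply.
case: (arg_minnP (fun j : 'I_l => val j) ri) => j rj min_j.
have /negP[] := negbT (none j); rewrite rj; apply/forallP => j'.
by apply/implyP; apply: min_j.
Qed.

Lemma ie_size_ffun (R : realType) N l (eps : R)
    (a1 : 'I_l -> 'I_N.+1) (a2 : opair l -> 'I_N.+1) :
  ie_size eps [ffun i => a1 i] [ffun p => a2 p] = ie_size eps a1 a2.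
Proof.
by rewrite /ie_size /atilde; congr (Num.truncn (_ - _ - _));
   apply: eq_bigr => i _; rewrite ffunE.
Qed.

(** Without the ceiling, the gap between the two sides is an integer at least [eps * N], hence at
    least its ceiling. This gap is the loss in [ie_lossy_retract]. *)
Lemma ie_size_leq (R : realType) N l (eps : R) (w : input (ie_problem N l eps)) :
  (0 <= eps)%R ->
  ie_size eps (iea1 w) (iea2 w) + \sum_p iea2 w p + `|Num.ceil (eps * N%:R)%R|
    <= \sum_i iea1 w i.
Proof.
move=> eps_ge0; set s := ie_size _ _ _; set B := \sum_p _; set A := \sum_i _.
have epsN : (0 <= eps * N%:R)%R by rewrite mulr_ge0.
have le_s : (s%:R <= A%:R - B%:R - eps * N%:R :> R)%R.
  rewrite /A /B !natr_sum -/(atilde _ _ _) truncn_le subr_ge0; exact: ie_ge.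
have le_AB : s + B <= A by rewrite -(ler_nat R) natrD; lra.
have : `|Num.ceil (eps * N%:R)%R| <= A - (s + B).
  by apply: absz_ceil_leq; rewrite epsN /= natrB // natrD; lra.
lia.
Qed.

(* The disjoint union of the S_i maps injectively to the disjoint union of their
   union and the S_i :&: S_j: a point of S_i goes to the union if i is the first
   index of a set containing it, and to S_j :&: S_i if j < i is that index.
   Everything is padded so that the sizes do not depend on the input. *)
Lemma ie_lossy_retract (R : realType) N l (eps : R)
    (e := `|Num.ceil (eps * N%:R)%R|)
    (d := (l + #|opair l|) * up_log 2 N.+1 + 2 * up_log 2 N + l + up_log 2 (l * N)) :
  0 < N -> 0 < l -> (0 < eps)%R -> e <= l * N ->
  lossy_retract (ie_problem N l eps) 'I_(l * N - e).+1 'I_(l * N).+1 d d.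
Proof.
move=> N_gt0 l_gt0 eps_gt0 le_e; pose P := ie_problem N l eps.
pose n0 := Ordinal N_gt0.
pose A1 (w : input P) := [ffun i => iea1 w i].
pose A2 (w : input P) := [ffun p => iea2 w p].
pose F1 i x (w : input P) := pad_val n0 (ief1 w i) x.
pose F2 p x (w : input P) := pad_val n0 (ief2 w p) x.
pose Ft x (w : input P) := pad_val n0 (ieft w) x.
pose G1 i x (w : input P) : nat := ieg1 w i x.
pose G2 p x (w : input P) : nat := ieg2 w p x.
pose Gt x (w : input P) : nat := iegt w x.
pose row (x : 'I_N) (w : input P) := [ffun i => ieT w i x].
pose sz2 (a1 : {ffun 'I_l -> 'I_N.+1}) (a2 : {ffun opair l -> 'I_N.+1})
    (j : unit + opair l) : nat :=
  if j is inr p then a2 p else ie_size eps a1 a2.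
pose sz1 (a1 : {ffun 'I_l -> 'I_N.+1}) (i : 'I_l) : nat := a1 i.
pose down (q : 'I_l * nat) (w : input P) : (unit + opair l) * nat :=
  let v := F1 q.1 q.2 w in
  if first_index (row v w) is Some j then
    if (insub (j, q.1) : option (opair l)) is Some p then (inr p, G2 p v w)
    else (inl tt, Gt v w)
  else (inl tt, 0).
pose up (q : (unit + opair l) * nat) (w : input P) : option ('I_l * nat) :=
  match q.1 with
  | inl _ => let v := Ft q.2 w in
      if first_index (row v w) is Some j then Some (j, G1 j v w) else None
  | inr p => Some ((val p).2, G1 (val p).2 (F2 p q.2 w) w)
  end.
(* Numbers past the last block are shifted past the last block on the other side; the two ends
   differ by at least [e], so the shift fits. *)
pose gn a1 a2 (y : 'I_(l * N).+1) w : 'I_(l * N - e).+1 :=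
  if block_dec (sz1 a1) y is Some q then inord (block_enc (sz2 a1 a2) (down q w))
  else inord (\sum_j sz2 a1 a2 j + (y - \sum_i sz1 a1 i)).
pose fn a1 a2 (z : 'I_(l * N - e).+1) w : 'I_(l * N).+1 :=
  if block_dec (sz2 a1 a2) z is Some q then
    if up q w is Some q' then inord (block_enc (sz1 a1) q') else ord0
  else inord (\sum_i sz1 a1 i + (z - \sum_j sz2 a1 a2 j)).
(* If [y] codes [(i, x)], the blame falls on [f_i], [g_i] when they fail at [x], and otherwise on
   the union or the intersection to which [down] sends the point. *)
pose sol a1 (y : 'I_(l * N).+1) (w : input P) : solution P :=
  if block_dec (sz1 a1) y is Some (i, x) then
    let v := F1 i x w in let r := row v w in
    if ~~ r i || (G1 i v w != x) then inl (inl (i, insubd n0 x))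
    else if first_index r is Some j then
      if (insub (j, i) : option (opair l)) is Some p then inl (inr (p, v)) else inr v
    else inr v
  else inr n0.
have cA1 : computable (l * up_log 2 N.+1) A1.
  rewrite -[X in X * _]card_ord; apply: computable_ffun => i.
  rewrite -[up_log _ _]muln1; apply: (computable_ord ord0) => b.
  exact: (@computable_query P (inl (inl (inl (inl (inl (inr (i, b)))))))).
have cA2 : computable (#|opair l| * up_log 2 N.+1) A2.
  apply: computable_ffun => p.
  rewrite -[up_log _ _]muln1; apply: (computable_ord ord0) => b.
  exact: (@computable_query P (inl (inl (inl (inl (inr (p, b))))))).
have pad_big a x (f : 'I_a -> 'I_N) : a <= x -> pad_val n0 f x = n0.
  by move=> le; rewrite /pad_val insubF // ltnNge le.
have a1_le w i : iea1 (w : input P) i <= N by rewrite -ltnS.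
have a2_le w p : iea2 (w : input P) p <= N by rewrite -ltnS.
have size_le w : ie_size eps (iea1 (w : input P)) (iea2 w) + \sum_p iea2 w p + e <= \sum_i iea1 w i.
  by apply: ie_size_leq; apply: ltW.
have sum_le w : \sum_i iea1 (w : input P) i <= l * N.
  rewrite -[X in _ <= X * _]card_ord -sum_nat_const.
  by apply: leq_sum => i _; apply: a1_le.
have lN_gt0 : 0 < l * N by rewrite muln_gt0 l_gt0.
(* Arguments beyond the table have no position to query, but there the padded map is constant. *)
have cF1 i x : computable (up_log 2 N) (F1 i x).
  have [lt|le] := ltnP x N; last first.
    apply: (computable_ext (h := fun=> n0)); last exact: computable_const.
    by move=> w; rewrite /F1 pad_big //; apply: leq_trans le.
  rewrite -[up_log _ _]muln1; apply: (computable_ord n0) => b.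
  apply: computable_ext (@computable_query P
    (inl (inl (inl (inr (inl i, Ordinal lt, b)))))) => w.
  by rewrite /= (bit_pad_val (n0 := n0)).
have cF2 p x : computable (up_log 2 N) (F2 p x).
  have [lt|le] := ltnP x N; last first.
    apply: (computable_ext (h := fun=> n0)); last exact: computable_const.
    by move=> w; rewrite /F2 pad_big //; apply: leq_trans le.
  rewrite -[up_log _ _]muln1; apply: (computable_ord n0) => b.
  apply: computable_ext (@computable_query P
    (inl (inl (inl (inr (inr p, Ordinal lt, b)))))) => w.
  by rewrite /= (bit_pad_val (n0 := n0)).
have cFt x : computable (up_log 2 N) (Ft x).
  have [lt|le] := ltnP x (l * N); last first.
    apply: (computable_ext (h := fun=> n0)); last exact: computable_const.
    move=> w; rewrite /Ft pad_big //; apply: leq_trans le.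
    by have := size_le w; have := sum_le w; lia.
  rewrite -[up_log _ _]muln1; apply: (computable_ord n0) => b.
  apply: computable_ext (@computable_query P (inl (inr (Ordinal lt, b)))) => w.
  by rewrite /= (bit_pad_val (n0 := n0)).
have lt_up K x : 0 < K -> x <= K -> forall y : 'I_(maxn x 1), y < 2 ^ up_log 2 K.
  move=> K_gt0 le y; apply: leq_trans (ltn_ord y) _.
  by apply: leq_trans (up_logP K _) => //; rewrite geq_max le.
have cG1 i x : computable (up_log 2 N) (G1 i x).
  rewrite -[up_log _ _]muln1; apply: computable_bits => [w|b]; first exact: lt_up.
  exact: (@computable_query P (inl (inl (inr (inl i, x, b))))).
have cG2 p x : computable (up_log 2 N) (G2 p x).
  rewrite -[up_log _ _]muln1; apply: computable_bits => [w|b]; first exact: lt_up.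
  exact: (@computable_query P (inl (inl (inr (inr p, x, b))))).
have cGt x : computable (up_log 2 (l * N)) (Gt x).
  rewrite -[up_log _ _]muln1; apply: computable_bits => [w|b].
    by apply: lt_up => //; have := size_le w; have := sum_le w; lia.
  exact: (@computable_query P (inr (x, b))).
have crow x : computable l (row x).
  rewrite -[X in computable X _]muln1 -[X in X * _]card_ord; apply: computable_ffun => i.
  exact: (@computable_query P (inl (inl (inl (inl (inl (inl (i, x)))))))).
have cdown q : computable (2 * up_log 2 N + l + up_log 2 (l * N)) (down q).
  apply: (@computable_weaken _ (up_log 2 N + (l + (up_log 2 N + up_log 2 (l * N))))).
    by lia.
  pose k r v w := if first_index r is Some j then
    if (insub (j, q.1) : option (opair l)) is Some p then (inr p, G2 p v w)
    else (inl tt, Gt v w) else (inl tt, 0).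
  apply: (@computable_bind P _ _ _ _ (F1 q.1 q.2) (fun v w => k (row v w) v w)) => // v.
  apply: (@computable_bind P _ _ _ _ (row v) (fun r w => k r v w)) => // r.
  rewrite /k; case: first_index => [j|]; last exact: computable_const.
  case: insub => [p|].
    by apply: (computable_map (pair (inr p))); apply: computable_weaken (cG2 _ _); lia.
  by apply: (computable_map (pair (inl tt))); apply: computable_weaken (cGt _); lia.
have cup q : computable (2 * up_log 2 N + l) (up q).
  case: q => [[[]|p] x].
    apply: (@computable_weaken _ (up_log 2 N + (l + up_log 2 N))); first by lia.
    pose k r v w := if first_index r is Some j then Some (j, G1 j v w) else None.
    apply: (@computable_bind P _ _ _ _ (Ft x) (fun v w => k (row v w) v w)) => // v.
    apply: (@computable_bind P _ _ _ _ (row v) (fun r w => k r v w)) => // r.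
    rewrite /k; case: first_index => [j|]; last exact: computable_const.
    exact: (computable_map (fun z => Some (j, z))).
  apply: (@computable_weaken _ (up_log 2 N + up_log 2 N)); first by lia.
  apply: (@computable_bind P _ _ _ _ (F2 p x)
    (fun v w => Some ((val p).2, G1 (val p).2 v w))) => // v.
  exact: (computable_map (fun z => Some ((val p).2, z))).
(* All [a_i] and [a_ij] are read first; afterwards the block arithmetic needs no query. *)
have with_sizes T (h : {ffun 'I_l -> 'I_N.+1} -> {ffun opair l -> 'I_N.+1} -> input P -> T) :
    (forall a1 a2, computable (2 * up_log 2 N + l + up_log 2 (l * N)) (h a1 a2)) ->
    computable d (fun w => h (A1 w) (A2 w) w).
  move=> ch; apply: (@computable_weaken _ (l * up_log 2 N.+1 + (#|opair l| * up_log 2 N.+1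
    + (2 * up_log 2 N + l + up_log 2 (l * N))))); first by rewrite /d mulnDl; lia.
  apply: (@computable_bind P _ _ _ _ A1 (fun a w => h a (A2 w) w)) => // a1.
  exact: (@computable_bind P _ _ _ _ A2 (fun a w => h a1 a w)).
exists (fun z w => fn (A1 w) (A2 w) z w), (fun y w => gn (A1 w) (A2 w) y w),
  (fun y w => sol (A1 w) y w).
split=> [z|y|y|w y].
- apply: (with_sizes _ (fun a1 a2 w => fn a1 a2 z w)) => a1 a2; rewrite /fn.
  case: block_dec => [q|]; last exact: computable_const.
  apply: (computable_map (fun o => if o is Some q' then inord (block_enc (sz1 a1) q') else ord0)).
  by apply: computable_weaken (cup q); lia.
- apply: (with_sizes _ (fun a1 a2 w => gn a1 a2 y w)) => a1 a2; rewrite /gn.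
  case: block_dec => [q|]; last exact: computable_const.
  by apply: (computable_map (fun q' => inord (block_enc (sz2 a1 a2) q'))).
- apply: (with_sizes _ (fun a1 _ w => sol a1 y w)) => a1 _; rewrite /sol.
  case: block_dec => [[i x]|]; last exact: computable_const.
  apply: (@computable_weaken _ (up_log 2 N + (l + up_log 2 N))); first by lia.
  pose k (z : nat) (r : {ffun 'I_l -> bool}) (v : 'I_N) : solution P :=
    if ~~ r i || (z != x) then inl (inl (i, insubd n0 x))
    else if first_index r is Some j then
      if (insub (j, i) : option (opair l)) is Some p then inl (inr (p, v)) else inr v
    else inr v.
  apply: (@computable_bind P _ _ _ _ (F1 i x)
    (fun v w => k (G1 i v w) (row v w) v)) => // v.
  apply: (@computable_bind P _ _ _ _ (row v) (fun r w => k (G1 i v w) r v)) => // r.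
  exact: (computable_map (fun z => k z r v)).
have s1E : \sum_i sz1 (A1 w) i = \sum_i iea1 w i.
  by apply: eq_bigr => i _; rewrite /sz1 ffunE.
have s2E : \sum_j sz2 (A1 w) (A2 w) j = ie_size eps (iea1 w) (iea2 w) + \sum_p iea2 w p.
  rewrite big_sumType /= (big_pred1 tt) ?ie_size_ffun; last by case.
  by congr (_ + _); apply: eq_bigr => p _; rewrite ffunE.
have sw := size_le w; have tw := sum_le w.
have ylt := ltn_ord y.
rewrite /sol /fn /gn; case E: (block_dec (sz1 (A1 w)) y) => [[i x]|]; last first.
  have le_y := block_dec_None E; case/eqP.
  rewrite s1E in le_y *; rewrite s2E.
  have ub : ie_size eps (iea1 w) (iea2 w) + \sum_p iea2 w p + (y - \sum_i iea1 w i)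
      < (l * N - e).+1 by lia.
  have zE := inordK ub.
  by rewrite block_dec_ge ?zE ?s2E ?leq_addr //= addKn subnKC // inord_val.
have [/= lt_x encE] := block_decP E.
rewrite /sz1 ffunE in lt_x.
have [x' x'E] : exists x' : 'I_(iea1 w i), x = x' by exists (Ordinal lt_x).
pose v := ief1 w i x'.
have vE : F1 i x w = v by rewrite /F1 /pad_val x'E valK.
rewrite /= vE; case: ifPn => [bad _|].
  have xN : x < N by apply: leq_trans lt_x (a1_le _ _).
  by rewrite /= val_insubd xN x'E valK /=; move: bad; rewrite ffunE x'E.
rewrite negb_or !negbK ffunE => /andP[Tiv /eqP Gx].
have [|j [jE rj le_j]] := @first_indexP _ (row v w) i; first by rewrite ffunE.
rewrite jE; rewrite ffunE in rj.
(* It suffices that [up] undoes [down] at [(i, x)]: then [y] does not move. *)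
have fix_y q : down (i, x) w = q -> up q w = Some (i, x) ->
    q.2 < sz2 (A1 w) (A2 w) q.1 ->
    (if block_dec (sz2 (A1 w) (A2 w)) (@inord (l * N - e)
        (block_enc (sz2 (A1 w) (A2 w)) (down (i, x) w))) is Some q
     then if up q w is Some q' then inord (block_enc (sz1 (A1 w)) q') else ord0
     else inord (\sum_i sz1 (A1 w) i + (@inord (l * N - e)
        (block_enc (sz2 (A1 w) (A2 w)) (down (i, x) w)) - \sum_j sz2 (A1 w) (A2 w) j))) = y.
  move=> -> upq ltq; rewrite inordK ?block_encK // ?upq ?encE ?inord_val //.
  by apply: ltn_trans (block_enc_lt ltq) _; rewrite s2E; lia.
have downE : down (i, x) w = if (insub (j, i) : option (opair l)) is Some p
    then (inr p, G2 p v w) else (inl tt, Gt v w) by rewrite /down /= vE jE.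
case: insubP downE => [p _ pE|ge_ij] downE ne /=; last first.
  have eq_ij : j = i.
    by apply/val_inj/eqP; rewrite eqn_leq le_j leqNgt.
  apply/andP; split; last by apply/existsP; exists i.
  apply: contraNT ne => /(not_retractPn n0)[lt_g ftE]; apply/eqP.
  apply: (fix_y (inl tt, Gt v w)) => //=; last by rewrite ie_size_ffun.
  by rewrite /up /= /Ft ftE jE eq_ij Gx.
have [pj pi] : (val p).1 = j /\ (val p).2 = i by rewrite pE.
rewrite pj pi rj Tiv /=.
apply: contraNT ne => /(not_retractPn n0)[lt_g f2E]; apply/eqP.
apply: (fix_y (inr p, G2 p v w)) => //=; last by rewrite ffunE.
by rewrite /up /= /F2 f2E pi Gx.
Qed.

(** * Amplification and cost for Inclusion-Exclusion *)

Lemma expn_bernoulli s e n : s ^ n.+1 + n.+1 * e * s ^ n <= (s + e) ^ n.+1.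
Proof.
elim: n => [|n IHn]; first by rewrite !expn1 expn0 mul1n muln1.
rewrite [X in _ <= X]expnS; apply: leq_trans (leq_mul (leqnn _) IHn).
by rewrite !(expnS s n.+1) (expnS s n); move: (s ^ n) => x; nia.
Qed.

Lemma double_expn_leq s e n : s <= n.+1 * e -> 2 * s ^ n.+1 <= (s + e) ^ n.+1.
Proof.
move=> le; apply: leq_trans (expn_bernoulli s e n).
by rewrite mul2n -addnn leq_add2l expnS leq_mul2r le orbT.
Qed.

(** [atilde] is at most [l * N], while an index puts no upper bound on [eps]. *)
Lemma ie_input_empty (R : realType) N l (eps : R) :
  (0 <= eps)%R -> l * N < `|Num.ceil (eps * N%:R)%R| ->
  input (ie_problem N l eps) -> False.
Proof.
move=> eps_ge0 lt_e w; have := ie_size_leq w eps_ge0.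
have : \sum_i iea1 w i <= l * N.
  rewrite -[X in _ <= X * _]card_ord -sum_nat_const.
  by apply: leq_sum => i _; rewrite -ltnS.
lia.
Qed.

Lemma ie_reduction (R : realType) N l (eps : R) r
    (e := `|Num.ceil (eps * N%:R)%R|)
    (d := (l + #|opair l|) * up_log 2 N.+1 + 2 * up_log 2 N + l + up_log 2 (l * N)) :
  0 < N -> 0 < l -> (0 < eps)%R -> l * N <= r.+1 * e ->
  exists2 M, 0 < M <= 2 ^ (up_log 2 (l * N) * r.+1) &
    reduction (ie_problem N l eps) (lossy_problem M) ((2 * r.+1 + 1) * d).
Proof.
move=> N_gt0 l_gt0 eps_gt0 le.
have [le_e|lt_e] := leqP e (l * N); last first.
  exists 1; first by rewrite expn_gt0.
  apply: reduction_empty (ie_input_empty (ltW eps_gt0) lt_e) _.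
  exact: (inr (Ordinal N_gt0)).
have e_gt0 : 0 < e by rewrite absz_gt0 gt_eqF // ceil_gt0 mulr_gt0 ?ltr0n.
have := lossy_retract_power r (ie_lossy_retract N_gt0 l_gt0 eps_gt0 le_e).
rewrite -/e -/d => /lossy_retract_reduction.
rewrite !card_ffun !card_ord expn_gt0 /= => /(_ isT) red.
exists ((l * N - e).+1 ^ r.+1).
  rewrite expn_gt0 /= expnM leq_exp2r //.
  by apply: leq_trans (@up_logP 2 (l * N) isT); lia.
have -> : (2 * r.+1 + 1) * d = maxn (r.+1 * d) (r.+1 * (d + d) + d) by lia.
(* The base [s = l * N - e + 1] satisfies [s <= l * N <= r.+1 * e] because [e > 0]. *)
apply: red; have -> : (l * N).+1 = (l * N - e).+1 + e by lia.
by apply: double_expn_leq; lia.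
Qed.

Lemma ie_cost_leq q Q l o u1 u2 u3 L : q <= Q -> l <= q -> o <= l * l ->
  u3 <= L -> u2 <= L -> u1 <= L.+1 -> 0 < q ->
  2 * (u3 * (q * q).+1) + 2 + (2 * (q * q).+1 + 1) * ((l + o) * u1 + 2 * u2 + l + u3)
    <= 40 * (Q ^ 4 * L.+1).
Proof.
move=> le_q le_l le_o le3 le2 le1 q_gt0.
have Q_gt0 : 0 < Q by apply: leq_trans q_gt0 le_q.
have qq : (q * q).+1 <= 2 * (Q * Q) by have := leq_mul le_q le_q; nia.
have oQ : o <= Q * Q by apply: leq_trans le_o _; apply: leq_mul; apply: leq_trans le_q.
have le_QQ : Q <= Q * Q by rewrite leq_pmulr.
have le_lQ : l <= Q * Q by apply: leq_trans le_l (leq_trans le_q le_QQ).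
have -> : Q ^ 4 = (Q * Q) * (Q * Q) by rewrite !expnS expn0 muln1 !mulnA.
move: (Q * Q) qq oQ le_QQ le_lQ => W qq oW QW lW.
have W_gt0 : 0 < W by apply: leq_trans QW.
have le_W : W <= W * W by rewrite leq_pmulr.
have h1 : u3 * (q * q).+1 <= 2 * (W * W * L.+1).
  apply: (@leq_trans (L.+1 * (2 * W))); first by apply: leq_mul; lia.
  by rewrite mulnC -mulnA leq_mul2l /= leq_mul2r le_W orbT.
have h2 : (l + o) * u1 + 2 * u2 + l + u3 <= 6 * (W * L.+1).
  have : (l + o) * u1 <= (2 * W) * L.+1 by apply: leq_mul; lia.
  have : L.+1 <= W * L.+1 by rewrite leq_pmull.
  have : W <= W * L.+1 by rewrite leq_pmulr.
  lia.
have h3 : (2 * (q * q).+1 + 1) * ((l + o) * u1 + 2 * u2 + l + u3) <= (5 * W) * (6 * (W * L.+1)).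
  by apply: leq_mul => //; lia.
have h4 : 0 < W * W * L.+1 by rewrite !muln_gt0 W_gt0.
lia.
Qed.

Lemma ie_to_lossy (R : realType) k :
  0 < k -> dt_reducible (inclusion_exclusion R k) lossy_code.
Proof.
move=> k_gt0; apply: (@dt_reducibleI _ _ (40 * k.+1 ^ 4) (4 * k + 1)).
move=> [N l eps N_gt0 l_le eps_gt] /=; set q := polylog k N in l_le eps_gt.
have q_gt0 : 0 < q by rewrite /q /polylog; lia.
have eps_gt0 : (0 < eps)%R by apply: le_lt_trans eps_gt; rewrite invr_ge0.
set e := `|Num.ceil (eps * N%:R)%R|.
have le_Nqe : N <= q * e.
  rewrite -(ler_nat R) natrM; apply: (@le_trans _ _ (q%:R * (eps * N%:R))%R).
    rewrite mulrA ler_peMl // -ler_pdivrMl ?ltr0n // mulr1; exact: ltW.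
  by rewrite ler_wpM2l // absz_ceil_ge // mulr_ge0 // ltW.
(* [eps > 1/q] and [l <= q] make the relative loss at least about [1/q^2], so a power of order [q^2]
   doubles the ratio. *)
have le_lN : l * N <= (q * q).+1 * e.
  apply: (@leq_trans (q * (q * e))); first exact: leq_mul.
  by rewrite mulnA leq_mul2r leqnSn orbT.
(* Without any set [atilde] is 0, below [eps * N], so there is no legal input. *)
have [l0|l_gt0] := posnP l.
  exists (exist (fun M => 0 < M) 1 isT), 0; split=> /=.
    apply: reduction_empty; last exact: (inr (Ordinal N_gt0)).
    apply: ie_input_empty; first exact: ltW.
    by rewrite l0 absz_gt0 gt_eqF // ceil_gt0 mulr_gt0 ?ltr0n.
  apply: leq_trans (_ : 2 <= _); last first.
    by apply: (@leq_mul 2 1); rewrite ?expn_gt0 //; apply: (@leq_mul 2 1); rewrite ?expn_gt0.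
  by rewrite addn0; apply: (@lossy_length_leq 1 0).
have [M /andP[M_gt0 leM] red] := ie_reduction N_gt0 l_gt0 eps_gt0 le_lN.
set d := _ * _ in red; exists (exist (fun M => 0 < M) M M_gt0), d; split=> //=.
set L := up_log 2 (input_length (ie_problem _ _ _)).
have le_u : up_log 2 (l * N) <= L.
  apply: leq_up_log; rewrite /input_length /= /ie_position !card_sum.
  by rewrite card_prod !card_ord; lia.
have le_U := lossy_length_leq leM.
have le_u2 : up_log 2 N <= L.
  by apply: leq_trans le_u; apply: leq_up_log; rewrite leq_pmull.
have le_u1 : up_log 2 N.+1 <= L.+1.
  apply: up_log_min => //; rewrite expnS mul2n -addnn -addn1.
  apply: leq_add; rewrite ?expn_gt0 //.
  by apply: leq_trans (@up_logP 2 N isT) _; rewrite leq_exp2l.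
have le_o := card_opair_leq l.
(* [Q] bounds [q] in terms of the input length, through [up_log 2 N <= L]. *)
pose Q := k.+1 * L.+1 ^ k.
have le_qQ : q <= Q.
  rewrite /q /polylog /Q mulSn; apply: leq_add.
    by rewrite leq_exp2r // (leq_trans le_u2).
  by rewrite leq_pmulr // expn_gt0.
have -> : 40 * k.+1 ^ 4 * L.+1 ^ (4 * k + 1) = 40 * (Q ^ 4 * L.+1).
  by rewrite /Q expnMn expnD expn1 mulnC (mulnC 4) expnM; lia.
apply: leq_trans (leq_add le_U (leqnn d)) _; rewrite /d.
exact: ie_cost_leq le_qQ l_le le_o le_u le_u2 le_u1 q_gt0.
Qed.

Theorem theorem6p6 (R : realType) :
  [/\ forall c : R, (1 < c)%R -> lossy_complete (amgm_lc c),
      forall c : R, (0 < c)%R -> (c < 2)%R -> lossy_complete (dual_amgm_lc c)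
    & forall k : nat, (0 < k)%N -> lossy_complete (inclusion_exclusion R k)].
Proof.
split=> [c c1 | c c0 c2 | k k0]; split.
- exact: amgm_to_lossy.
- exact: lossy_to_amgm.
- exact: dual_amgm_to_lossy.
- exact: lossy_to_dual_amgm.
- exact: ie_to_lossy.
- exact: lossy_to_ie.
Qed.
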